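(* Let $\alpha\in(0,1)$, let $G\subset\mathbb{R}^d$ ($d\ge 1$) be a (bounded) Lipschitz domain, let $G_0\subset G$ be a measurable subset of positive Lebesgue measure, and let $T>0$, $y_0\in L^2(G)\setminus\{0\}$ and $u\in L^\infty((0,T)\times G_0)$. For $\xi\in\mathbb{R}$ let $y(\cdot,\cdot;\xi;y_0;u)$ be the solution of the time-fractional Schrödinger equation $\partial^{\alpha}_{0,t}y-\xi\,\mathrm{i}\,\Delta y=\mathds{1}_{G_0}u$ in $(0,T)\times G$ with $y=0$ on $(0,T)\times\partial G$ and $y(0,\cdot)=y_0$ in $G$. Then the set $$\mathscr{E}:=\left\{\xi\in\mathbb{R}\;:\;y(T,\cdot;\xi;y_0;u)=0\right\}$$ is countable.
   Context: $L^2(G)=L^2(G;\mathbb{C})$ with its Hermitian inner product $\langle\cdot,\cdot\rangle$. $\{\lambda_n\}_{n\in\mathbb{N}}$ (with $\mathbb N=\{0,1,2,\dots\}$) are the eigenvalues of the Dirichlet Laplacian $-\Delta$ on $G$, with $0<\lambda_0\le\lambda_1\le\cdots\to\infty$, and $\{e_n\}_{n\in\mathbb{N}}$ is a corresponding Hilbert basis of $L^2(G)$ of eigenfunctions. $\partial^{\alpha}_{0,t}y(t)=\frac{1}{\Gamma(1-\alpha)}\int_0^t(t-\tau)^{-\alpha}\partial_\tau y(\tau)\,\mathrm{d}\tau$ is the Caputo derivative. $\mathds{1}_{G_0}$ is the indicator function of $G_0$. The two-parameter Mittag--Leffler function is $E_{\alpha,\beta}(z)=\sum_{n=0}^{\infty}\frac{z^n}{\Gamma(\alpha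 n+\beta)}$, $z\in\mathbb{C}$. For $\xi\in\mathbb R$, the solution of the system is given by $$y(t,\cdot;\xi;y_0;u)=\sum_{n=0}^{\infty}\left[\langle y_0,e_n\rangle E_{\alpha,1}(-\mathrm{i}\xi\lambda_nt^\alpha)+\int_0^t\langle\mathds{1}_{G_0}u(s,\cdot),e_n\rangle(t-s)^{\alpha-1}E_{\alpha,\alpha}(-\mathrm{i}\xi\lambda_n(t-s)^\alpha)\,\mathrm{d}s\right]e_n .$$ ''Countable'' means finite or countably infinite. *)

(* Defs.v *)
From HB Require Import structures.
From mathcomp Require Import all_boot all_order all_algebra.
From mathcomp Require Import all_classical all_reals all_analysis.
From mathcomp Require Import complex.
Set Implicit Arguments.
Unset Strict Implicit.
Unset Printing Implicit Defensive.
Import Order.TTheory GRing.Theory Num.Theory.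
Import numFieldNormedType.Exports.
Local Open Scope classical_set_scope.
Local Open Scope ring_scope.

(* Throughout, R^d is 'rV[R]_d and C is R[i]. *)

(* Borel sigma-algebra of R^d, generated by the coordinates as the library does
   for n.-tuple T. *)
Section measurable_rV.
Context {d} {T : measurableType d} (n : nat).

Let coord (i : 'I_n) (x : 'rV[T]_n) : T := x ord0 i.

Let rV_set0 : g_sigma_preimage coord set0.
Proof. exact: sigma_algebra0. Qed.

Let rV_setC A : g_sigma_preimage coord A -> g_sigma_preimage coord (~` A).
Proof. exact: sigma_algebraC. Qed.

Let rV_bigcup (F : _^nat) : (forall i, g_sigma_preimage coord (F i)) ->
  g_sigma_preimage coord (\bigcup_i (F i)).
Proof. exact: sigma_algebra_bigcup. Qed.

HB.instance Definition _ := @isMeasurable.Build (measure_tuple_display d)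
  'rV[T]_n (g_sigma_preimage coord) rV_set0 rV_setC rV_bigcup.

End measurable_rV.

Section measurable_cons_rV.
Context {d1 d2} {T1 : measurableType d1} {T2 : measurableType d2}.

Lemma measurable_coord n (i : 'I_n) :
  measurable_fun [set: 'rV[T2]_n] (fun x : 'rV[T2]_n => x ord0 i).
Proof.
move=> _ Y mY; rewrite setTI; apply: sub_sigma_algebra => /=.
rewrite -bigcup_seq/=; exists i => /=; first by rewrite mem_index_enum.
by exists Y => //; rewrite setTI.
Qed.

Lemma measurable_fun_rVP n (f : T1 -> 'rV[T2]_n) :
  measurable_fun [set: T1] f <->
  forall i, measurable_fun [set: T1] (fun x => f x ord0 i).
Proof.
split=> [mf i|mf]; first exact: measurableT_comp (measurable_coord i) mf.
move=> _ A mA; rewrite setTI.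
rewrite -[_ @^-1` _]setTI.
suff H : g_sigma_preimage (fun i x => f x ord0 i) `<=` measurable.
  apply: H.
  rewrite (@g_sigma_preimage_comp _ _ _ _ (fun i (x : 'rV[T2]_n) => x ord0 i)).
  by exists A.
apply: smallest_sub; first exact: sigma_algebra_measurable.
by rewrite -bigcup_seq/= => B [i _ [C mC <-]]; exact: mf.
Qed.
End measurable_cons_rV.


Section lebesgue_rV.
Context {R : realType}.

Definition consr n (p : R * 'rV[R]_n) : 'rV[R]_n.+1 :=
  row_mx (const_mx p.1 : 'rV_1) p.2.

Definition unconsr n (x : 'rV[R]_n.+1) : R * 'rV[R]_n :=
  (x ord0 ord0, \row_i x ord0 (lift ord0 i)).

Lemma consrE0 n (p : R * 'rV[R]_n) : consr p ord0 ord0 = p.1.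
Proof. by rewrite /consr mxE; case: splitP => // j; rewrite mxE. Qed.

Lemma consrES n (p : R * 'rV[R]_n) (i : 'I_n) :
  consr p ord0 (lift ord0 i) = p.2 ord0 i.
Proof.
rewrite /consr mxE; case: splitP => [[[|j] //]|k /= [ik]].
by congr (_ _ _); apply: val_inj.
Qed.

Lemma consrK n : cancel (@consr n) (@unconsr n).
Proof.
move=> [a x]; rewrite /unconsr consrE0; congr (_, _).
by apply/rowP => i; rewrite mxE consrES.
Qed.

Lemma unconsrK n : cancel (@unconsr n) (@consr n).
Proof.
move=> x; apply/rowP => i; have [j ->|->] := unliftP ord0 i.
- by rewrite consrES mxE.
- by rewrite consrE0.
Qed.

Lemma measurable_consr n : measurable_fun [set: R * 'rV[R]_n] (@consr n).
Proof.
apply/measurable_fun_rVP => i; have [j ->|->] := unliftP ord0 i.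
- under [X in measurable_fun _ X]eq_fun do rewrite consrES.
  by apply: (measurableT_comp (measurable_coord j)).
- under [X in measurable_fun _ X]eq_fun do rewrite consrE0.
  exact: measurable_fst.
Qed.

Lemma measurable_unconsr n : measurable_fun [set: 'rV[R]_n.+1] (@unconsr n).
Proof.
apply/measurable_fun_pairP; split; first exact: measurable_coord.
apply/measurable_fun_rVP => i.
under [X in measurable_fun _ X]eq_fun do rewrite /= mxE.
exact: measurable_coord.
Qed.

Section lebesgue_step.
Local Open Scope ereal_scope.
Variables (n : nat) (m : {sigma_finite_measure set 'rV[R]_n -> \bar R}).

Definition lebesgue_step : set 'rV[R]_n.+1 -> \bar R :=
  pushforward (@lebesgue_measure R \x m) (@consr n).

Let step0 : lebesgue_step set0 = 0.
Proof. by rewrite /lebesgue_step /pushforward preimage_set0 measure0. Qed.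

Let step_ge0 A : 0 <= lebesgue_step A.
Proof. by rewrite /lebesgue_step /pushforward measure_ge0. Qed.

Let step_sigma_additive : semi_sigma_additive lebesgue_step.
Proof.
have mc A : measurable A -> measurable (@consr n @^-1` A).
  by move=> mA; rewrite -[X in measurable X]setTI; exact: measurable_consr.
move=> F mF tF mUF; rewrite /lebesgue_step /pushforward preimage_bigcup.
apply: measure_semi_sigma_additive.
- by move=> k; exact: mc.
- apply/trivIsetP => /= i j _ _ ij; rewrite -preimage_setI.
  by move/trivIsetP : tF => /(_ _ _ _ _ ij) ->//; rewrite preimage_set0.
- by rewrite -preimage_bigcup; exact: mc.
Qed.

HB.instance Definition _ :=
  isMeasure.Build _ _ _ lebesgue_step step0 step_ge0 step_sigma_additive.

Let step_sigma_finite : sigma_finite setT lebesgue_step.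
Proof.
have mT : sigma_finite setT (@lebesgue_measure R \x m).
  have /sigma_finiteP[F [TF ndF Foo]] := sigma_finiteT (@lebesgue_measure R).
  have /sigma_finiteP[G [TG ndG Goo]] := sigma_finiteT m.
  exists (fun k => F k `*` G k).
    rewrite -setXTT TF TG predeqE => -[x y]; split=> [[[i _ Fx] [j _ Gy]]|].
      exists (maxn i j) => //; split.
      - by move/subsetPset: (ndF _ _ (leq_maxl i j)); exact.
      - by move/subsetPset: (ndG _ _ (leq_maxr i j)); exact.
    by move=> [k _ [? ?]]; split; exists k.
  move=> k; have [? ?] := Foo k; have [? ?] := Goo k.
  split; first exact: measurableX.
  by rewrite product_measure1E// lte_mul_pinfty// ge0_fin_numE.
have [F TF Foo] := mT; exists (fun k => @unconsr n @^-1` F k).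
  by rewrite -preimage_bigcup -TF preimage_setT.
move=> k; have [mF Fk] := Foo k; split.
  by rewrite -[X in measurable X]setTI; exact: measurable_unconsr.
rewrite /lebesgue_step /pushforward -comp_preimage.
suff -> : @unconsr n \o @consr n = id by [].
by apply/funext => p /=; rewrite consrK.
Qed.

HB.instance Definition _ :=
  Measure_isSigmaFinite.Build _ _ _ lebesgue_step step_sigma_finite.

End lebesgue_step.

(* Lebesgue measure on the Borel sets of R^n: lebesgue_rV_box below
   characterizes it. *)
Fixpoint lebesgue_rV n : {sigma_finite_measure set 'rV[R]_n -> \bar R} :=
  match n with
  | 0 => \d_(0 : 'rV[R]_0)
  | n'.+1 => lebesgue_step (lebesgue_rV n')
  end.

Lemma lebesgue_rV_box n (A : 'I_n -> set R) : (forall i, measurable (A i)) ->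
  lebesgue_rV n [set x | forall i, A i (x ord0 i)] =
  (\prod_(i < n) lebesgue_measure (A i))%E.
Proof.
elim: n A => [|n IHn] A mA.
  rewrite big_ord0 /= diracE; congr (_%:E).
  by rewrite mem_set //= => -[].
rewrite big_ord_recl -(IHn (fun i => A (lift ord0 i))) //.
have mB : measurable
    [set x : 'rV[R]_n | forall i, A (lift ord0 i) (x ord0 i)].
  rewrite (_ : [set _ | _] = \bigcap_(i in [set: 'I_n])
     (fun x : 'rV[R]_n => x ord0 i) @^-1` (A (lift ord0 i))); last first.
    by apply/seteqP; split => x /= H i; [move=> _|]; exact: H.
  apply: fin_bigcap_measurable => [|i _]; first exact: finite_finset.
  by rewrite -[X in measurable X]setTI; exact: measurable_coord.
have mA0 : measurable (A ord0 : set (measurableTypeR R)) := mA ord0.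
rewrite -product_measure1E //.
rewrite /= /lebesgue_step /pushforward; congr (_ _).
apply/seteqP; split => -[a x] /= H.
- split; first by have := H ord0; rewrite consrE0.
  by move=> i; have := H (lift ord0 i); rewrite consrES.
- move=> i; case: H => Ha Hx; have [j ->|->] := unliftP ord0 i.
  + by rewrite consrES; exact: Hx.
  + by rewrite consrE0.
Qed.
End lebesgue_rV.

Section completed_measures.
Context (R : realType) (d : nat).
Local Open Scope ereal_scope.

(* R^d and R x R^d with the sigma-algebras of all Lebesgue measurable sets *)
Definition lebesgue_space : measurableType _ :=
  caratheodory_type (@lebesgue_rV R d)^*%mu.

Definition leb : {measure set lebesgue_space -> \bar R} :=
  @completed_measure_extension _ _ _ (@lebesgue_rV R d).

Definition lebesgue_spacetime : measurableType _ :=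
  caratheodory_type (@lebesgue_measure R \x @lebesgue_rV R d)^*%mu.

Definition leb_spacetime : {measure set lebesgue_spacetime -> \bar R} :=
  @completed_measure_extension _ _ _ (@lebesgue_measure R \x @lebesgue_rV R d).

End completed_measures.

Section complex_functions.
Context {disp : measure_display} {T : measurableType disp} {R : realType}.
Variable mu : {measure set T -> \bar R}.
Implicit Types (D : set T) (f g : T -> R[i]).

Definition cmeasurable_fun D f :=
  measurable_fun D (fun x => complex.Re (f x)) /\
  measurable_fun D (fun x => complex.Im (f x)).

Definition cintegral D f : R[i] :=
  ((\int[mu]_(x in D) complex.Re (f x)) +i*
   (\int[mu]_(x in D) complex.Im (f x)))%C.

Definition L2norm D f : \bar R :=
  Lnorm mu 2%:E ((fun x => (Normc.normc (f x))%:E) \_ D).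

Definition L2 D f := cmeasurable_fun D f /\ (L2norm D f < +oo)%E.

Definition inner D f g : R[i] := cintegral D (fun x => f x * conjc (g x)).

Definition Linfty D f := cmeasurable_fun D f /\
  exists M : R, {ae mu, forall x, D x -> Normc.normc (f x) <= M}.

Definition ae_zero D f := {ae mu, forall x, D x -> f x = 0}.

Definition hilbert_basis D (e : nat -> T -> R[i]) :=
  [/\ forall n, L2 D (e n),
      forall m n, inner D (e m) (e n) = (m == n)%:R &
      (* the linear span is dense *)
      forall f, L2 D f -> forall eps : R, 0 < eps ->
        exists N (c : nat -> R[i]),
          (L2norm D (fun x => f x - \sum_(n < N) c n * e n x)%R
             < eps%:E)%E].

End complex_functions.

Section domains.
Context (R : realType) (d : nat).
Implicit Types (x y nu : 'rV[R]_d) (G : set 'rV[R]_d).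

Definition dotr x y : R := \sum_(i < d) x ord0 i * y ord0 i.

(* Near each boundary point, G is the strict epigraph, in some unit direction
   nu, of a Lipschitz function gamma of the component of x orthogonal to nu. *)
Definition bounded_lipschitz_domain G :=
  [/\ open G, connected G, G !=set0, bounded_set G &
      forall x0, (closure G `\` G°) x0 ->
        exists (nu : 'rV[R]_d) (gamma : 'rV[R]_d -> R) (U : set 'rV[R]_d),
          [/\ dotr nu nu = 1, lipschitz gamma, nbhs x0 U &
              forall x, U x ->
                (G x <-> gamma (x - dotr x nu *: nu) < dotr x nu)]].

End domains.

Section dirichlet_laplacian.
Context (R : realType) (d : nat).
Implicit Types (G : set 'rV[R]_d) (phi f : 'rV[R]_d -> R[i]).

Definition partial (i : 'I_d) (g : 'rV[R]_d -> R) : 'rV[R]_d -> R :=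
  fun x => 'D_(delta_mx ord0 i) g x.

Fixpoint C_class (k : nat) (g : 'rV[R]_d -> R) : Prop :=
  match k with
  | 0 => continuous g
  | k'.+1 => continuous g /\
      forall i : 'I_d, (forall x, derivable g x (delta_mx ord0 i)) /\
                       C_class k' (partial i g)
  end.

Definition cpartial (i : 'I_d) phi : 'rV[R]_d -> R[i] := fun x =>
  (partial i (fun z => complex.Re (phi z)) x +i*
   partial i (fun z => complex.Im (phi z)) x)%C.

(* C_c^oo(G; C) *)
Definition test_function G phi :=
  [/\ forall k, C_class k (fun x => complex.Re (phi x)) /\
                C_class k (fun x => complex.Im (phi x)),
      compact (closure [set x | phi x != 0]) &
      closure [set x | phi x != 0] `<=` G].

(* f belongs to H^1_0(G; C), the H^1-closure of C_c^oo(G; C), and Df is its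
   weak gradient. *)
Definition H10_gradient G f (Df : 'I_d -> 'rV[R]_d -> R[i]) :=
  [/\ L2 (leb R d) G f, forall i, L2 (leb R d) G (Df i) &
      exists phi : nat -> 'rV[R]_d -> R[i],
        [/\ forall k, test_function G (phi k),
            L2norm (leb R d) G (fun x => phi k x - f x) @[k --> \oo] --> 0%E &
            forall i, L2norm (leb R d) G (fun x => cpartial i (phi k) x - Df i x)
                        @[k --> \oo] --> 0%E]].

(* -Delta f = l f in G with f = 0 on the boundary, in the variational sense *)
Definition dirichlet_eigenfunction G (l : R) f :=
  exists Df, H10_gradient G f Df /\
    forall phi, test_function G phi ->
      \sum_(i < d) inner (leb R d) G (Df i) (cpartial i phi) =
      l%:C%C * inner (leb R d) G f phi.

Definition dirichlet_eigenbasis G (lam : nat -> R)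
    (e : nat -> 'rV[R]_d -> R[i]) :=
  [/\ 0 < lam 0%N, nondecreasing_seq lam, lam n @[n --> \oo] --> +oo,
      forall n, dirichlet_eigenfunction G (lam n) (e n) &
      hilbert_basis (leb R d) G e].

End dirichlet_laplacian.

Section mittag_leffler.
Context {R : realType}.

(* Euler's integral; only used at positive arguments *)
Definition Gamma (x : R) : R :=
  \int[lebesgue_measure]_(t in `]0, +oo[) (t `^ (x - 1) * expR (- t)).

Definition mittag_leffler (a b : R) (z : R[i]) : R[i] :=
  lim (series (fun n => z ^+ n / (Gamma (a * n%:R + b))%:C%C
               : (R[i] : numFieldType)) @ \oo).

End mittag_leffler.

Section fractional_schrodinger.
Context (R : realType) (d : nat).
Variables (alpha : R) (G G0 : set 'rV[R]_d) (lam : nat -> R)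
  (e : nat -> 'rV[R]_d -> R[i]) (y0 : 'rV[R]_d -> R[i])
  (u : R -> 'rV[R]_d -> R[i]).

(* E_(alpha,b)(- i xi lam_n t^alpha) *)
Definition mode_propagator (b xi : R) (n : nat) (t : R) : R[i] :=
  mittag_leffler alpha b (- 'i%C * (xi * lam n * t `^ alpha)%:C%C).

Definition solution_mode (xi : R) (n : nat) (t : R) : R[i] :=
  inner (leb R d) G y0 (e n) * mode_propagator 1 xi n t +
  cintegral completed_lebesgue_measure `]0, t[ (fun s =>
    inner (leb R d) G (fun x => (\1_G0 x)%:C%C * u s x) (e n) *
    ((t - s) `^ (alpha - 1))%:C%C * mode_propagator alpha xi n (t - s)).

(* y is the solution on [0, T] of
     d_t^alpha y - xi i Delta y = 1_G0 u,  y = 0 on the boundary,  y(0) = y0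
   (d_t^alpha the Caputo derivative), which for u merely bounded is understood
   through its eigenfunction expansion: for every t, the series of modes
   converges to y(t) in L^2(G). *)
Definition fractional_schrodinger_solution (T xi : R)
    (y : R -> 'rV[R]_d -> R[i]) :=
  forall t, 0 <= t <= T ->
    L2 (leb R d) G (y t) /\
    L2norm (leb R d) G
      (fun x => y t x - \sum_(n < N) solution_mode xi n t * e n x)
      @[N --> \oo] --> 0%E.

End fractional_schrodinger.

(* Main.v *)
Require Import Defs.
From mathcomp Require Import all_boot all_order all_algebra.
From mathcomp Require Import all_classical all_reals all_analysis.
From mathcomp Require Import complex measurable_realfun.
From mathcomp Require Import ring lra.
Set Implicit Arguments.
Unset Strict Implicit.
Unset Printing Implicit Defensive.
Import Order.TTheory GRing.Theory Num.Theory.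
Import numFieldNormedType.Exports.
Local Open Scope classical_set_scope.
Local Open Scope ring_scope.

(** If the solution vanishes at time T for the parameter xi, then each of its
    modes vanishes, because the mode of index n is the scalar product of the
    solution with e_n ([hilbert_basis_coeff_eq0]). Since y_0 is not zero, some
    c = <y_0, e_n> is not zero ([hilbert_basis_total]), and it suffices to show
    that, for this n, the mode at time T has countably many zeros xi.

    Put x = xi lambda_n, and let h (s) be the scalar product of the source at
    time s with e_n. Expanding both Mittag-Leffler functions and integrating
    term by term, the mode is an everywhere convergent power series in x
    ([coord_solution_mode]) whose k-th coefficient is, with p = alpha (k + 1),

      (-i)^k (c T^(alpha k) / Gamma (alpha k + 1)
              + 1 / Gamma p * int_0^T h (s) (T - s)^(p - 1) ds).

    An entire power series with uncountably many real zeros has infinitely many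
    of them in some interval [-B, B], and then all its coefficients vanish.
    This identity theorem is proved without complex analysis: dividing out N
    of these zeros shows that the sum is at most a constant times 2^(-N) on
    [-B, B] ([pseries_zeros_small]), and N is arbitrary.

    The coefficients cannot all vanish ([mode_coeff_eq0]). As h is bounded by
    some K, the integral is at most K T^p / p, so that their vanishing would
    give p Gamma p <= C Gamma (alpha k + 1) for a constant C and every k. As
    Gamma (p + 1) <= p Gamma p, this bounds the quotients of consecutive values
    of Gamma at the arguments alpha k + 1, and Gamma would grow at most
    geometrically along them, which is absurd ([Gamma_not_geometric]).

    Measurability of h needs some care, as the source is only measurable for
    the completed product measure: off a null set it is replaced by a Borel
    function, to which Tonelli's theorem applies ([inner_slice]). The real and
    imaginary parts of all these series are handled as two real series. *)

(** * Power series with infinitely many zeros in a bounded set *)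

Section power_series_zeros.
Context {R : realType}.
Implicit Types (c : R^nat) (r M B x a : R).

(** The Cauchy estimate of radius r: it gives convergence for |x| < r, and it
    is checked coefficient by coefficient. *)
Definition coeff_bound c r M := forall n, `|c n| * r ^+ n <= M.

(** The coefficients of (f x - f a) / (x - a), for f the sum of the power
    series with coefficients c. *)
Definition divide_zero a c : R^nat :=
  fun n => limn (pseries (fun j => c (n.+1 + j)%N) a).

Lemma pseries0 c x : pseries c x 0 = 0.
Proof. by rewrite /pseries/series/= big_geq. Qed.

Lemma pseries_recr c x N : pseries c x N.+1 = pseries c x N + c N * x ^+ N.
Proof. by rewrite /pseries/series/= big_nat_recr. Qed.

Lemma coeff_bound_ge0 c r M : coeff_bound c r M -> 0 <= M.
Proof. by move=> /(_ 0%N); rewrite expr0 mulr1; apply: le_trans. Qed.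

Lemma coeff_bound_term c r M x n : 0 < r -> coeff_bound c r M ->
  `|c n * x ^+ n| <= M * (`|x| / r) ^+ n.
Proof.
move=> r0 cM; rewrite normrM normrX expr_div_n mulrA ler_pdivlMr ?exprn_gt0//.
by rewrite mulrAC ler_wpM2r ?exprn_ge0.
Qed.

Lemma coeff_bound_normed_cvg c r M x : 0 < r -> coeff_bound c r M ->
  `|x| < r -> cvgn [normed series (fun n => c n * x ^+ n)].
Proof.
move=> r0 cM xr; apply: (@series_le_cvg _ _ (geometric M (`|x| / r))) => //=.
- move=> n; rewrite mulr_ge0 ?(coeff_bound_ge0 cM)// exprn_ge0// divr_ge0//.
  exact: ltW.
- by move=> n; exact: coeff_bound_term.
- apply: is_cvg_geometric_series.
  by rewrite ger0_norm ?divr_ge0// ?(ltW r0)// ltr_pdivrMr// mul1r.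
Qed.

Lemma coeff_bound_cvg c r M x : 0 < r -> coeff_bound c r M -> `|x| < r ->
  cvgn (pseries c x).
Proof. by move=> r0 cM xr; exact/normed_cvg/(coeff_bound_normed_cvg r0 cM). Qed.

Lemma coeff_bound_partial_le c r M x N : 0 < r -> coeff_bound c r M ->
  `|x| <= r / 2 -> `|pseries c x N| <= 2 * M.
Proof.
move=> r0 cM xr; have M0 := coeff_bound_ge0 cM.
apply: (@le_trans _ _ (2 * M - 2 * M / 2 ^+ N)); last first.
  by rewrite gerBl divr_ge0 ?mulr_ge0// exprn_ge0.
elim: N => [|N IH].
  by rewrite pseries0 normr0 expr0 divr1 subrr.
rewrite pseries_recr (le_trans (ler_normD _ _))//.
apply: (le_trans (lerD IH (coeff_bound_term x N r0 cM))).
have : M * (`|x| / r) ^+ N <= M * 2^-1 ^+ N.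
  rewrite ler_wpM2l// lerXn2r ?nnegrE ?divr_ge0// ?(ltW r0)//.
  by rewrite ler_pdivrMr// mulrC.
have -> : 2 * M / 2 ^+ N.+1 = M * 2^-1 ^+ N.
  by rewrite exprS exprVn; field; rewrite expf_neq0.
by rewrite exprVn; lra.
Qed.

Lemma coeff_bound_pseries_le c r M x : 0 < r -> coeff_bound c r M ->
  `|x| <= r / 2 -> `|limn (pseries c x)| <= 2 * M.
Proof.
move=> r0 cM xr; have cv : cvgn (pseries c x) by apply: (coeff_bound_cvg r0 cM); lra.
rewrite -lim_norm//; apply: limr_le; first exact: is_cvg_norm.
by apply: nearW => N; exact: (coeff_bound_partial_le N r0 cM).
Qed.

Lemma coeff_bound_drop c r M n : 0 < r -> coeff_bound c r M ->
  coeff_bound (fun j => c (n + j)%N) r (M / r ^+ n).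
Proof.
move=> r0 cM j; rewrite ler_pdivlMr ?exprn_gt0// -mulrA -exprD addnC.
exact: cM.
Qed.

Lemma coeff_bound_mul (a c : R^nat) K r M : 0 <= r -> (forall n, `|a n| <= K) ->
  coeff_bound c r M -> coeff_bound (fun n => a n * c n) r (K * M).
Proof.
move=> r0 aK cM n; rewrite normrM -mulrA.
by apply: ler_pM; rewrite ?mulr_ge0 ?exprn_ge0.
Qed.

Lemma coeff_bound_add (c c' : R^nat) r M M' : 0 <= r -> coeff_bound c r M ->
  coeff_bound c' r M' -> coeff_bound (fun n => c n + c' n) r (M + M').
Proof.
move=> r0 cM cM' n; apply: le_trans (lerD (cM n) (cM' n)).
by rewrite -mulrDl ler_wpM2r ?exprn_ge0// ler_normD.
Qed.

Lemma coeff_bound_scale c (l : R) r M : 0 <= l -> coeff_bound c (l * r) M ->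
  coeff_bound (fun n => c n * l ^+ n) r M.
Proof.
move=> l0 cM n; rewrite normrM (ger0_norm (exprn_ge0 _ l0)) -mulrA -exprMn.
exact: cM.
Qed.

Lemma pseries_scale c (l x : R) :
  pseries c (x * l) = pseries (fun n => c n * l ^+ n) x.
Proof.
apply/funext => N; elim: N => [|N IH]; first by rewrite !pseries0.
by rewrite !pseries_recr IH exprMn; congr (_ + _); ring.
Qed.

Lemma lim_pseries_comb (c c' : R^nat) (p q x : R) :
  cvgn (pseries c x) -> cvgn (pseries c' x) ->
  limn (pseries (fun n => p * c n + q * c' n) x) =
  p * limn (pseries c x) + q * limn (pseries c' x).
Proof.
move=> cv cv'; apply/cvg_lim => //.
have -> : pseries (fun n => p * c n + q * c' n) x =
    (fun N => p * pseries c x N + q * pseries c' x N).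
  apply/funext => N; elim: N => [|N IH]; first by rewrite !pseries0 !mulr0 addr0.
  by rewrite !pseries_recr IH; ring.
by apply: cvgD; apply: cvgM => //; exact: cvg_cst.
Qed.

(** A coefficient of the quotient is a shifted tail of the series, evaluated at
    a; as |a| <= r / 2, it is at most twice the estimate of its first term. *)
Lemma divide_zero_bound c r M a : 0 < r -> coeff_bound c r M ->
  `|a| <= r / 2 -> coeff_bound (divide_zero a c) r (2 * M / r).
Proof.
move=> r0 cM ar n.
have := coeff_bound_pseries_le r0 (coeff_bound_drop n.+1 r0 cM) ar.
rewrite -/(divide_zero a c n) => /(ler_wpM2r (exprn_ge0 n (ltW r0))).
move=> /le_trans; apply; rewrite le_eqVlt; apply/orP; left; apply/eqP.
rewrite exprS; field.
by rewrite expf_neq0 ?gt_eqF.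
Qed.

Lemma pseries_drop1 c r M x : 0 < r -> coeff_bound c r M -> `|x| < r ->
  limn (pseries c x) = c 0%N + x * limn (pseries (fun j => c j.+1) x).
Proof.
move=> r0 cM xr.
have cvg1 := coeff_bound_cvg r0 (coeff_bound_drop 1 r0 cM) xr.
apply/cvg_lim => //; rewrite -cvg_shiftS.
have -> : (fun n => pseries c x n.+1) =
          (fun n => c 0%N + x * pseries (fun j => c j.+1) x n).
  apply/funext => n; rewrite /pseries/series/= big_nat_recl// expr0 mulr1.
  by congr (_ + _); rewrite mulr_sumr; apply: eq_bigr => i _; rewrite exprS mulrCA.
by apply: cvgD; [exact: cvg_cst|apply: cvgM; [exact: cvg_cst|exact: cvg1]].
Qed.

(** The partial sums telescope, up to a remainder that tends to 0. *)
Lemma pseries_divide_zero c r M a x : 0 < r -> coeff_bound c r M ->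
  `|a| <= r / 2 -> `|x| < r ->
  limn (pseries c x) - limn (pseries c a) =
  (x - a) * limn (pseries (divide_zero a c) x).
Proof.
move=> r0 cM ar xr; have ar' : `|a| < r by lra.
have cd := divide_zero_bound r0 cM ar.
have dE n : divide_zero a c n = c n.+1 + a * divide_zero a c n.+1.
  rewrite /divide_zero (pseries_drop1 r0 (coeff_bound_drop n.+1 r0 cM) ar').
  by rewrite addn0; do 2 f_equal; under eq_fun do rewrite addnS -addSn.
have fa : limn (pseries c a) = c 0%N + a * divide_zero a c 0.
  by rewrite (pseries_drop1 r0 cM ar').
have partial N : (x - a) * pseries (divide_zero a c) x N =
    pseries c x N - limn (pseries c a) + (c N + a * divide_zero a c N) * x ^+ N.
  elim: N => [|N IH].
    by rewrite fa !pseries0 mulr0 expr0 mulr1 sub0r addNr.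
  by rewrite !pseries_recr mulrDr IH -dE exprS; ring.
have cvg0 d M' : coeff_bound d r M' -> (fun N => d N * x ^+ N) @ \oo --> (0 : R).
  move=> dM; apply: cvg_series_cvg_0; exact: (coeff_bound_cvg r0 dM xr).
have : (fun N => (x - a) * pseries (divide_zero a c) x N) @ \oo -->
    limn (pseries c x) - limn (pseries c a) + (0 + a * 0).
  under eq_fun do rewrite partial mulrDl -mulrA.
  apply: cvgD; first apply: cvgB; [exact: (coeff_bound_cvg r0 cM xr)|exact: cvg_cst|].
  by apply: cvgD; [exact: (cvg0 _ _ cM)|apply: cvgM; [exact: cvg_cst|exact: (cvg0 _ _ cd)]].
rewrite mulr0 !addr0 => /cvg_lim <- //.
apply/cvg_lim => //; apply: cvgM; first exact: cvg_cst.
exact: (coeff_bound_cvg r0 cd xr).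
Qed.

(** Dividing out one zero a in [-B, B] halves the bound that is available on
    [-B, B]: the factor x - a is at most 2 B there, while the estimate of
    radius 8 B of the quotient is 2 / (8 B) times that of the series. *)
Lemma pseries_zeros_small B N c M : 0 < B -> coeff_bound c (8 * B) M ->
  infinite_set [set x | `|x| <= B /\ limn (pseries c x) = 0] ->
  forall x, `|x| <= B -> `|limn (pseries c x)| <= 2 * M / 2 ^+ N.
Proof.
move=> B0; have r0 : 0 < 8 * B by rewrite mulr_gt0.
elim: N c M => [|N IH] c M cM Zinf x xB.
  rewrite expr0 divr1; apply: (coeff_bound_pseries_le r0 cM); lra.
have [a [aB fa0]] := infinite_setN0 Zinf.
have ar : `|a| <= 8 * B / 2 by lra.
have fE z : `|z| <= B ->
    limn (pseries c z) = (z - a) * limn (pseries (divide_zero a c) z).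
  move=> zB; have zr : `|z| < 8 * B by lra.
  by rewrite -(pseries_divide_zero r0 cM ar zr) fa0 subr0.
have cd := divide_zero_bound r0 cM ar.
have {}IH := IH _ _ cd _ x xB.
rewrite fE// normrM.
apply: (@le_trans _ _ (2 * B * (2 * (2 * M / (8 * B)) / 2 ^+ N))).
  apply: ler_pM => //; last first.
    apply: IH; apply: sub_infinite_set (infinite_setD Zinf (finite_set1 a)).
    move=> z [[zB]]; rewrite fE// => /eqP; rewrite mulf_eq0 subr_eq0 => + /= za.
    by move=> /orP[/eqP//|/eqP z0]; split.
  rewrite (le_trans (ler_normB _ _))//; lra.
rewrite le_eqVlt; apply/orP; left; apply/eqP.
by rewrite exprS; field; rewrite expf_neq0//= gt_eqF.
Qed.

Lemma pseries_zeros_eq0 B c M : 0 < B -> coeff_bound c (8 * B) M ->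
  infinite_set [set x | `|x| <= B /\ limn (pseries c x) = 0] ->
  forall x, `|x| <= B -> limn (pseries c x) = 0.
Proof.
move=> B0 cM Zinf x xB; have M0 := coeff_bound_ge0 cM.
apply/eqP; rewrite -normr_le0; apply/ler_addgt0Pl => e e0; rewrite addr0.
have : (2 * M) * 2^-1 ^+ n @[n --> \oo] --> (2 * M) * 0.
  apply: cvgM; first exact: cvg_cst.
  by apply: cvg_expr; rewrite ger0_norm//; lra.
rewrite mulr0 => /cvgrPdist_le/(_ e e0)[N _ /(_ N (leqnn N))] /=.
rewrite sub0r normrN ger0_norm ?mulr_ge0// ?exprn_ge0 ?invr_ge0// => h.
by apply: le_trans h; rewrite exprVn; exact: (pseries_zeros_small N B0 cM).
Qed.

Lemma lim_pseries_at0 c r M : 0 < r -> coeff_bound c r M ->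
  limn (pseries c 0) = c 0%N.
Proof. by move=> r0 cM; rewrite (pseries_drop1 r0 cM) ?normr0// mul0r addr0. Qed.

(** Since the sum vanishes identically, so does the constant coefficient; the
    remaining factor x is divided out and the argument repeats. *)
Lemma pseries_zeros_coeff0 B c M : 0 < B -> coeff_bound c (8 * B) M ->
  infinite_set [set x | `|x| <= B /\ limn (pseries c x) = 0] ->
  forall n, c n = 0.
Proof.
move=> B0 + + n; have r0 : 0 < 8 * B by rewrite mulr_gt0.
elim: n c M => [|n IH] c M cM Zinf;
  (have c0 : c 0%N = 0; first by
    rewrite -(lim_pseries_at0 r0 cM) (pseries_zeros_eq0 B0 cM Zinf)// normr0 ltW).
  exact: c0.
apply: (IH (fun j => c j.+1) _ (coeff_bound_drop 1 r0 cM)).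
apply: sub_infinite_set (infinite_setD Zinf (finite_set1 0)).
move=> z [[zB fz]] /= z0; split => //.
have zr : `|z| < 8 * B by lra.
move: fz; rewrite (pseries_drop1 r0 cM zr) c0 add0r => /eqP.
by rewrite mulf_eq0 => /orP[/eqP//|/eqP].
Qed.

(** An uncountable subset of the line has infinitely many points in some
    interval [-B, B]. *)
Lemma pseries_uncountable_zeros c (A : set R) :
  (forall r, 0 < r -> exists M, coeff_bound c r M) ->
  (forall x, A x -> limn (pseries c x) = 0) -> ~ countable A ->
  forall n, c n = 0.
Proof.
move=> cM A0 Auncount n; apply: contrapT => cn; apply: Auncount.
have -> : A = \bigcup_k (A `&` [set x | `|x| <= k.+1%:R]).
  apply/seteqP; split=> [x Ax|x [k _ []]//].
  exists (Num.truncn `|x|) => //; split => //=; exact/ltW/truncnS_gt.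
apply: bigcup_countable => // k _; apply: finite_set_countable.
apply: contrapT => inf; apply: cn.
have k0 : (0 : R) < k.+1%:R by [].
have [|M {}cM] := cM (8 * k.+1%:R); first by rewrite mulr_gt0.
apply: (pseries_zeros_coeff0 k0 cM); apply: sub_infinite_set inf.
by move=> x [Ax xk]; split => //; exact: A0.
Qed.

End power_series_zeros.

(** * The Gamma function at positive arguments *)

Section calculus.
Context {R : realType}.
Notation mu := (@lebesgue_measure R).

Lemma is_derive_FTC2 (F f : R -> R) (a b : R) : a < b ->
  (forall x, x \in `[a, b] -> is_derive x 1 F (f x)) ->
  (forall x, x \in `[a, b] -> {for x, continuous f}) ->
  (\int[mu]_(x in `[a, b]) (f x)%:E = (F b - F a)%:E)%E.
Proof.
move=> ab dF cf.
have cF x : x \in `[a, b] -> {for x, continuous F}.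
  by move=> /dF[dx _]; exact/differentiable_continuous/derivable1_diffP.
have aab : a \in `[a, b] by rewrite in_itv/= lexx ltW.
have bab : b \in `[a, b] by rewrite in_itv/= lexx ltW.
rewrite EFinB; apply: (@continuous_FTC2 R f F) => //.
- by apply: continuous_in_subspaceT => x /set_mem; exact: cf.
- split.
  + by move=> x /subset_itv_oo_cc /dF[].
  + exact/cvg_at_right_filter/cF.
  + exact/cvg_at_left_filter/cF.
- move=> x /subset_itv_oo_cc /dF[dx dE].
  by rewrite derive1E.
Qed.

Lemma continuous_itv_integrable (f : R -> R) (a b : R) :
  (forall x, x \in `[a, b] -> {for x, continuous f}) ->
  mu.-integrable `[a, b] (EFin \o f).
Proof.
move=> cf; apply: continuous_compact_integrable; first exact: segment_compact.
by apply: continuous_in_subspaceT => x /set_mem; exact: cf.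
Qed.

End calculus.

Section gamma_function.
Context {R : realType}.
Notation mu := (@lebesgue_measure R).
Implicit Types (x t K : R) (n : nat).

Definition gamma_integrand x t := t `^ (x - 1) * expR (- t).

Let a_ n : R := n.+2%:R^-1.
Let b_ n : R := n.+2%:R.

Let a_gt0 n : 0 < a_ n. Proof. by rewrite invr_gt0. Qed.

Let ab_lt n : a_ n < b_ n.
Proof.
have : (1 : R) < n.+2%:R by rewrite (ltr_nat R 1 n.+2).
by rewrite /a_ /b_ => n1; rewrite (@lt_trans _ _ 1)// invf_lt1// (lt_trans ltr01).
Qed.

Local Notation gamma_interval n := (`[a_ n, b_ n]%classic).

Let interval_gt0 n t : t \in `[a_ n, b_ n] -> 0 < t.
Proof. by rewrite in_itv/= => /andP[+ _]; exact: lt_le_trans. Qed.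

Lemma gamma_interval_nondecreasing : nondecreasing_seq (fun n => gamma_interval n).
Proof.
move=> m n mn; rewrite subsetEset => t; rewrite /= !in_itv/=.
move=> /andP[h1 h2]; apply/andP; split.
  by rewrite (le_trans _ h1)// lef_pV2 ?posrE// ler_nat.
by rewrite (le_trans h2)// ler_nat.
Qed.

Lemma bigcup_gamma_interval : \bigcup_n gamma_interval n = `]0, +oo[%classic.
Proof.
apply/seteqP; split=> [t [n _] /interval_gt0 t0|t]; first by rewrite /= in_itv/= t0.
rewrite /= in_itv/= andbT => t0.
exists (Num.truncn (t + t^-1)) => //=; rewrite /= in_itv/=.
have h : t + t^-1 < (Num.truncn (t + t^-1)).+2%:R.
  by apply: (lt_le_trans (truncnS_gt _)); rewrite ler_nat.
have tV0 : 0 < t^-1 by rewrite invr_gt0.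
apply/andP; split; last by rewrite /b_; lra.
rewrite /a_ -[leRHS]invrK lef_pV2 ?posrE//; lra.
Qed.

Lemma gamma_integrand_ge0 x t : 0 <= gamma_integrand x t.
Proof. by rewrite mulr_ge0 ?powR_ge0 ?expR_ge0. Qed.

Lemma is_derive_gamma_integrand x t : 0 < t ->
  is_derive t 1 (gamma_integrand (x + 1))
    (x * gamma_integrand x t - gamma_integrand (x + 1) t).
Proof.
move=> t0; rewrite /gamma_integrand addrK.
have := is_derive1_powR x t0; have := is_derive_expR (- t) => dE dP.
have dN : is_derive t 1 (fun t : R => expR (- t)) (- expR (- t)).
  by apply: is_derive_eq; rewrite /GRing.scale/=; ring.
apply: is_derive_eq; rewrite /GRing.scale/=; ring.
Qed.

Lemma continuous_gamma_integrand x t : 0 < t ->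
  {for t, continuous (gamma_integrand x)}.
Proof.
move=> t0; have := is_derive_gamma_integrand (x - 1) t0; rewrite subrK => -[d _].
exact/differentiable_continuous/derivable1_diffP.
Qed.

Lemma measurable_gamma_integrand x D : measurable D ->
  measurable_fun D (gamma_integrand x).
Proof.
move=> mD; apply: measurable_funM; first exact: measurable_funTS.
by apply: measurableT_comp => //; exact: measurable_funTS.
Qed.

(** Euler's integral over [1 / (n + 2), n + 2], where the integrand is
    continuous for every x and integration by parts is elementary. *)
Definition Gamma_trunc n x := \int[mu]_(t in gamma_interval n) gamma_integrand x t.

Lemma gamma_integrand_integrable_trunc n x :
  mu.-integrable (gamma_interval n) (EFin \o gamma_integrand x).
Proof.
by apply: continuous_itv_integrable => t /interval_gt0; exact: continuous_gamma_integrand.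
Qed.

Lemma Gamma_truncE n x :
  (\int[mu]_(t in gamma_interval n) (gamma_integrand x t)%:E = (Gamma_trunc n x)%:E)%E.
Proof.
rewrite /Gamma_trunc /Rintegral fineK//; apply: integrable_fin_num => //.
exact: gamma_integrand_integrable_trunc.
Qed.

Lemma Gamma_trunc_rec n x : x * Gamma_trunc n x - Gamma_trunc n (x + 1) =
  gamma_integrand (x + 1) (b_ n) - gamma_integrand (x + 1) (a_ n).
Proof.
rewrite /Gamma_trunc -RintegralZl//; last exact: gamma_integrand_integrable_trunc.
rewrite -RintegralB//; last exact: gamma_integrand_integrable_trunc; last first.
  exact: integrableZl (gamma_integrand_integrable_trunc n x).
have dF t (tab : t \in `[a_ n, b_ n]) :=
  is_derive_gamma_integrand x (interval_gt0 tab).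
have cf t : t \in `[a_ n, b_ n] -> {for t, continuous
    (fun t => x * gamma_integrand x t - gamma_integrand (x + 1) t)}.
  move=> /interval_gt0 t0; apply: cvgB.
    by apply: cvgM; [exact: cvg_cst|exact: continuous_gamma_integrand].
  exact: continuous_gamma_integrand.
by rewrite /Rintegral (is_derive_FTC2 (ab_lt n) dF cf).
Qed.

Lemma Gamma_trunc_cvg x :
  ((Gamma_trunc n x)%:E @[n --> \oo] -->
   \int[mu]_(t in `]0%R, +oo[) (gamma_integrand x t)%:E)%E.
Proof.
rewrite -bigcup_gamma_interval; under eq_fun do rewrite -Gamma_truncE.
apply: ge0_nondecreasing_set_cvg_integral => //.
- exact: gamma_interval_nondecreasing.
- by move=> i; apply/measurable_EFinP; exact: measurable_gamma_integrand.
- by move=> n t _; rewrite lee_fin gamma_integrand_ge0.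
Qed.

Lemma Gamma_trunc_rec_le n x : Gamma_trunc n (x + 1) <= x * Gamma_trunc n x + a_ n `^ x.
Proof.
have := Gamma_trunc_rec n x; rewrite {2}/gamma_integrand addrK.
have := gamma_integrand_ge0 (x + 1) (b_ n).
have : a_ n `^ x * expR (- a_ n) <= a_ n `^ x.
  by rewrite ler_piMr ?powR_ge0// -expR0 ler_expR oppr_le0 ltW.
lra.
Qed.

Lemma Gamma_trunc1_le n : Gamma_trunc n 1 <= 1.
Proof.
have dF t : t \in `[a_ n, b_ n] ->
    is_derive t 1 (fun t => - expR (- t)) (gamma_integrand 1 t).
  move=> _; rewrite /gamma_integrand subrr powRr0 mul1r.
  have := is_derive_expR (- t) => dE.
  by apply: is_derive_eq; rewrite /GRing.scale/=; ring.
have cf t : t \in `[a_ n, b_ n] -> {for t, continuous (gamma_integrand 1)}.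
  by move=> /interval_gt0; exact: continuous_gamma_integrand.
rewrite /Gamma_trunc /Rintegral (is_derive_FTC2 (ab_lt n) dF cf)/=.
have : expR (- a_ n) <= 1 by rewrite -expR0 ler_expR oppr_le0 ltW.
by have := expR_ge0 (- b_ n); lra.
Qed.

(** For x in [1, 2] the integrand is dominated by the sum of those at 1 and 2;
    the recurrence between x and x + 1 then leads down to the singular
    arguments in (0, 1), and up to all arguments above 2. *)
Lemma Gamma_trunc_bounded x : 0 < x -> exists K, forall n, Gamma_trunc n x <= K.
Proof.
have a1 n : a_ n <= 1 by rewrite invf_le1 ?ler1n.
have step y : 0 < y -> (exists K, forall n, Gamma_trunc n y <= K) ->
    exists K, forall n, Gamma_trunc n (y + 1) <= K.
  move=> y0 [K hK]; exists (y * K + 1) => n.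
  rewrite (le_trans (Gamma_trunc_rec_le _ _))// lerD ?ler_pM2l//.
  by rewrite -[leRHS](powRr0 (a_ n)) ger_powR ?a1 ?a_gt0// ltW.
have le12 y : 1 <= y <= 2 -> exists K, forall n, Gamma_trunc n y <= K.
  move=> /andP[y1 y2].
  have [|K hK] := step 1 ltr01; first by exists 1 => n; exact: Gamma_trunc1_le.
  exists (1 + K) => n.
  apply: (@le_trans _ _ (Gamma_trunc n 1 + Gamma_trunc n (1 + 1))); last first.
    by apply: lerD => //; exact: Gamma_trunc1_le.
  rewrite /Gamma_trunc -RintegralD//; try exact: gamma_integrand_integrable_trunc.
  apply: le_Rintegral => //; first exact: gamma_integrand_integrable_trunc.
    exact: integrableD (gamma_integrand_integrable_trunc n 1)
      (gamma_integrand_integrable_trunc n (1 + 1)).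
  move=> t /interval_gt0 t0; rewrite /gamma_integrand -mulrDl ler_wpM2r ?expR_ge0//.
  rewrite addrK subrr powRr0 (powRr1 (ltW t0)).
  have [t1|/ltW t1] := leP t 1.
    apply: (@le_trans _ _ 1); last by rewrite lerDl ltW.
    by rewrite -[leRHS](powRr0 t) ger_powR ?t0 ?t1// subr_ge0.
  apply: (@le_trans _ _ t); last by rewrite lerDr.
  by rewrite -[leRHS](powRr1 (ltW t0)) ler_powR// lerBlDr.
have le1 y : 0 < y <= 1 -> exists K, forall n, Gamma_trunc n y <= K.
  move=> /andP[y0 y1]; have [|K hK] := le12 (y + 1); first by apply/andP; split; lra.
  exists (y^-1 * (K + 1)) => n; rewrite ler_pdivlMl//.
  have := Gamma_trunc_rec n y; have := hK n; have := gamma_integrand_ge0 (y + 1) (a_ n).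
  suff : gamma_integrand (y + 1) (b_ n) <= 1 by lra.
  rewrite /gamma_integrand addrK expRN ler_pdivrMr ?expR_gt0// mul1r.
  have b1 : 1 <= b_ n by rewrite /b_ ler1n.
  apply: (@le_trans _ _ (b_ n `^ 1)); first by rewrite ler_powR.
  by rewrite powRr1 ?(le_trans ler01)//; have := expR_ge1Dx (b_ n); lra.
suff main m : forall y, 0 < y <= m.+1%:R -> exists K, forall n, Gamma_trunc n y <= K.
  move=> x0; apply: (main (Num.truncn x)); rewrite x0/=; exact/ltW/truncnS_gt.
elim: m => [//|m IH] y /andP[y0 ym]; have [y1|y1] := leP y 1; first by apply: le1; rewrite y0.
rewrite -(subrK 1 y); apply: step; first by rewrite subr_gt0.
by apply: IH; rewrite subr_gt0 y1 lerBlDr natr1.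
Qed.

Lemma gamma_integrand_integrable x : 0 < x ->
  mu.-integrable `]0, +oo[ (EFin \o gamma_integrand x).
Proof.
move=> x0; have [K hK] := Gamma_trunc_bounded x0.
apply/integrableP; split; first by apply/measurable_EFinP; exact: measurable_gamma_integrand.
under eq_integral do rewrite /= ger0_norm ?gamma_integrand_ge0//.
apply: (@le_lt_trans _ _ K%:E); last exact: ltry.
have h := @Gamma_trunc_cvg x.
by rewrite -(cvg_lim _ h)//; apply: lime_le; [apply/cvgP; exact: h|apply: nearW => n; rewrite lee_fin].
Qed.

Lemma GammaE x : 0 < x ->
  (\int[mu]_(t in `]0%R, +oo[) (gamma_integrand x t)%:E = (Gamma x)%:E)%E.
Proof.
move=> x0; rewrite /Gamma /Rintegral fineK//.
by apply: integrable_fin_num => //; exact: gamma_integrand_integrable.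
Qed.

Lemma cvg_Gamma_trunc x : 0 < x -> Gamma_trunc n x @[n --> \oo] --> Gamma x.
Proof.
by move=> x0; have := @Gamma_trunc_cvg x; rewrite GammaE// => /fine_cvg.
Qed.

(** Half of the functional equation: the boundary term at infinity of the
    integration by parts is kept only through its sign. *)
Lemma Gamma_add1_le x : 0 < x -> Gamma (x + 1) <= x * Gamma x.
Proof.
move=> x0; rewrite -[leRHS]addr0.
have x10 : 0 < x + 1 by rewrite addr_gt0.
have cl := cvg_Gamma_trunc x10.
have cr : x * Gamma_trunc n x + a_ n `^ x @[n --> \oo] --> x * Gamma x + 0.
  apply: cvgD; first by apply: cvgM; [exact: cvg_cst|exact: cvg_Gamma_trunc].
  have /cvg_at_rightP := powR_cvg0 x0; apply; split => [n|]; first exact: a_gt0.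
  rewrite (_ : a_ = (fun n => @harmonic R n.+1))//.
  by rewrite (cvg_shiftS (@harmonic R)); exact: cvg_harmonic.
rewrite -(cvg_lim _ cl)// -(cvg_lim _ cr)//; apply: ler_lim.
- by apply/cvgP; exact: cl.
- by apply/cvgP; exact: cr.
- by apply: nearW => n; exact: Gamma_trunc_rec_le.
Qed.

(** Faster than any exponential: restrict the integral to [A, A + 1]. *)
Lemma Gamma_ge x A : 1 <= x -> 0 < A -> A `^ (x - 1) * expR (- (A + 1)) <= Gamma x.
Proof.
move=> x1 A0; have x0 : 0 < x by rewrite (lt_le_trans ltr01).
pose b := A + 1; have Ab : A < b by rewrite ltrDl.
rewrite -lee_fin -GammaE// -/b.
apply: (@le_trans _ _ (\int[mu]_(t in `[A, b]) (gamma_integrand x t)%:E)%E); last first.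
  apply: ge0_subset_integral => //.
  - by apply/measurable_EFinP; exact: measurable_gamma_integrand.
  - by move=> t _; rewrite lee_fin gamma_integrand_ge0.
  - by move=> t /=; rewrite !in_itv/= andbT => /andP[+ _]; exact: lt_le_trans.
apply: (@le_trans _ _ (\int[mu]_(t in `[A, b]) (A `^ (x - 1) * expR (- b))%:E)%E).
  rewrite integral_cst//= lebesgue_measure_itv/= lte_fin Ab.
  by rewrite -EFinD /b [A + 1]addrC addrK mule1.
apply: ge0_le_integral => //.
- by move=> t _; rewrite lee_fin mulr_ge0 ?powR_ge0 ?expR_ge0.
- by apply/measurable_EFinP; exact: measurable_gamma_integrand.
- move=> t; rewrite /= in_itv/= => /andP[At tb]; rewrite lee_fin.
  apply: ler_pM; rewrite ?powR_ge0 ?expR_ge0// ?ler_expR ?lerN2//.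
  by apply: ge0_ler_powR => //; rewrite ?nnegrE ?subr_ge0// ?(ltW A0)// (le_trans (ltW A0)).
Qed.

Lemma Gamma_gt0 x : 0 < x -> 0 < Gamma x.
Proof.
move=> x0; have x1 : 1 <= x + 1 by lra.
have := Gamma_ge x1 ltr01; have := Gamma_add1_le x0; rewrite powR1 mul1r => h1 h2.
have : 0 < x * Gamma x by rewrite (lt_le_trans _ h1)// (lt_le_trans _ h2)// expR_gt0.
by rewrite pmulr_rgt0.
Qed.

End gamma_function.

(* Below, Gamma enters only through the lemmas of this section. *)
#[local] Opaque Gamma.

(** * Square-integrable complex functions *)

Section complex_facts.
Context {R : rcfType}.
Implicit Types (z w : R[i]).

Lemma Re_add z w : complex.Re (z + w) = complex.Re z + complex.Re w.
Proof. by case: z w => [? ?] [? ?]. Qed.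

Lemma Im_add z w : complex.Im (z + w) = complex.Im z + complex.Im w.
Proof. by case: z w => [? ?] [? ?]. Qed.

Lemma Re_opp z : complex.Re (- z) = - complex.Re z. Proof. by case: z. Qed.

Lemma Im_opp z : complex.Im (- z) = - complex.Im z. Proof. by case: z. Qed.

Lemma Re_mul z w : complex.Re (z * w) =
  complex.Re z * complex.Re w - complex.Im z * complex.Im w.
Proof. by case: z w => [? ?] [? ?]. Qed.

Lemma Im_mul z w : complex.Im (z * w) =
  complex.Re z * complex.Im w + complex.Im z * complex.Re w.
Proof. by case: z w => [? ?] [? ?]. Qed.

Lemma Re_conj z : complex.Re (conjc z) = complex.Re z. Proof. by case: z. Qed.

Lemma Im_conj z : complex.Im (conjc z) = - complex.Im z. Proof. by case: z. Qed.

Lemma complex_ext z w : complex.Re z = complex.Re w ->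
  complex.Im z = complex.Im w -> z = w.
Proof. by case: z w => [? ?] [? ?] /= -> ->. Qed.

Lemma normc_ge0 z : 0 <= Normc.normc z.
Proof. by case: z => a b; exact: sqrtr_ge0. Qed.

Lemma normc_sqr z : Normc.normc z ^+ 2 = complex.Re z ^+ 2 + complex.Im z ^+ 2.
Proof. by case: z => a b; rewrite sqr_sqrtr// addr_ge0// sqr_ge0. Qed.

Lemma ler_Re_normc z : `|complex.Re z| <= Normc.normc z.
Proof.
rewrite -[leLHS]ger0_norm// -ler_sqr ?nnegrE ?normc_ge0//.
by rewrite ger0_norm// real_normK ?num_real// normc_sqr lerDl sqr_ge0.
Qed.

Lemma ler_Im_normc z : `|complex.Im z| <= Normc.normc z.
Proof.
rewrite -[leLHS]ger0_norm// -ler_sqr ?nnegrE ?normc_ge0//.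
by rewrite ger0_norm// real_normK ?num_real// normc_sqr lerDr sqr_ge0.
Qed.

Lemma normc_le_normD z : Normc.normc z <= `|complex.Re z| + `|complex.Im z|.
Proof.
rewrite -ler_sqr ?nnegrE ?normc_ge0 ?addr_ge0// normc_sqr.
rewrite -(real_normK (num_real (complex.Re z))) -(real_normK (num_real (complex.Im z))).
by have := normr_ge0 (complex.Re z); have := normr_ge0 (complex.Im z); nra.
Qed.

Lemma normc_conj z : Normc.normc (conjc z) = Normc.normc z.
Proof. by case: z => a b; rewrite /= sqrrN. Qed.

Lemma normcM_conj z w : Normc.normc (z * conjc w) = Normc.normc z * Normc.normc w.
Proof. by rewrite Normc.normcM normc_conj. Qed.

Lemma normcD_sqr z w :
  Normc.normc (z + w) ^+ 2 <= 2 * Normc.normc z ^+ 2 + 2 * Normc.normc w ^+ 2.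
Proof.
rewrite !normc_sqr Re_add Im_add -subr_ge0.
set l := _ - _; suff -> : l = (complex.Re z - complex.Re w) ^+ 2 +
    (complex.Im z - complex.Im w) ^+ 2 by rewrite addr_ge0// sqr_ge0.
by rewrite /l; ring.
Qed.

End complex_facts.

Section L2_theory.
Context {disp : measure_display} {T : measurableType disp} {R : realType}.
Variables (mu : {measure set T -> \bar R}) (D : set T).
Hypothesis mD : measurable D.
Implicit Types (f g h : T -> R[i]) (c : R[i]).
Notation normc := Normc.normc.

Lemma measurable_normc f : cmeasurable_fun D f ->
  measurable_fun D (fun x => normc (f x)).
Proof.
move=> [mr mi].
have -> : (fun x => normc (f x)) =
    (fun x => (complex.Re (f x) ^+ 2 + complex.Im (f x) ^+ 2) `^ 2^-1).
  by apply/funext => x; case: (f x) => a b; rewrite powR12_sqrt// addr_ge0// sqr_ge0.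
apply: (measurableT_comp (measurable_powR _)).
by apply: measurable_funD; exact: (measurable_funX 2).
Qed.

Lemma cmeasurable_funD f g : cmeasurable_fun D f -> cmeasurable_fun D g ->
  cmeasurable_fun D (fun x => f x + g x).
Proof.
move=> [fr fi] [gr gi]; split.
- by under eq_fun do rewrite Re_add; exact: measurable_funD.
- by under eq_fun do rewrite Im_add; exact: measurable_funD.
Qed.

Lemma cmeasurable_funM f g : cmeasurable_fun D f -> cmeasurable_fun D g ->
  cmeasurable_fun D (fun x => f x * g x).
Proof.
move=> [fr fi] [gr gi]; split.
- under eq_fun do rewrite Re_mul; apply: measurable_funB; exact: measurable_funM.
- under eq_fun do rewrite Im_mul; apply: measurable_funD; exact: measurable_funM.
Qed.

Lemma cmeasurable_conj f : cmeasurable_fun D f -> cmeasurable_fun D (fun x => conjc (f x)).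
Proof.
move=> [fr fi]; split; first by under eq_fun do rewrite Re_conj.
by under eq_fun do rewrite Im_conj; exact: measurableT_comp.
Qed.

Lemma cmeasurable_cst c : cmeasurable_fun D (fun=> c).
Proof. by split; exact: measurable_cst. Qed.

Lemma L2norm_sqr f :
  (L2norm mu D f `^ 2 = \int[mu]_(x in D) (normc (f x) ^+ 2)%:E)%E.
Proof.
rewrite /L2norm poweR_Lnorm// [RHS]integral_mkcond; apply: eq_integral => x _.
rewrite /patch; case: ifPn => _; last by rewrite abse0 poweR0r.
by rewrite /= ger0_norm ?normc_ge0// powR_mulrn// normc_ge0.
Qed.

Lemma L2P f : L2 mu D f <-> cmeasurable_fun D f /\
  mu.-integrable D (fun x => (normc (f x) ^+ 2)%:E).
Proof.
have sqr_fin : (L2norm mu D f < +oo)%E <->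
    (\int[mu]_(x in D) (normc (f x) ^+ 2)%:E < +oo)%E.
  rewrite -L2norm_sqr; split; first exact: poweR_lty.
  by case: (L2norm mu D f) => [r| |]//; rewrite ?ltry// poweRyr.
rewrite /L2; split=> -[mf].
  move/sqr_fin => fin; split => //; apply/integrableP; split.
    by apply/measurable_EFinP/(measurable_funX 2)/measurable_normc.
  by under eq_integral do rewrite gee0_abs ?lee_fin ?sqr_ge0//.
move=> /integrableP[_ fin]; split => //; apply/sqr_fin.
by move: fin; under eq_integral do rewrite gee0_abs ?lee_fin ?sqr_ge0//.
Qed.

Lemma L2D f g : L2 mu D f -> L2 mu D g -> L2 mu D (fun x => f x + g x).
Proof.
move=> /L2P[mf fi] /L2P[mg gi]; apply/L2P; split; first exact: cmeasurable_funD.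
apply: (@le_integrable _ _ _ mu D mD _
    (fun x => (2%:E * (normc (f x) ^+ 2)%:E + 2%:E * (normc (g x) ^+ 2)%:E)%E)).
- by apply/measurable_EFinP/(measurable_funX 2)/measurable_normc/cmeasurable_funD.
- move=> x _; rewrite -!EFinM -EFinD !gee0_abs ?lee_fin ?sqr_ge0//.
    exact: normcD_sqr.
  by rewrite addr_ge0// mulr_ge0// sqr_ge0.
- by apply: integrableD => //; exact: integrableZl.
Qed.

Lemma L2Z c f : L2 mu D f -> L2 mu D (fun x => c * f x).
Proof.
move=> /L2P[mf fi]; apply/L2P; split.
  by apply: cmeasurable_funM => //; exact: cmeasurable_cst.
have := integrableZl mD (normc c ^+ 2) fi; apply: eq_integrable => // x _.
by rewrite Normc.normcM exprMn EFinM.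
Qed.

Lemma L2_lin_comb (c : nat -> R[i]) (e : nat -> T -> R[i]) N :
  (forall n, L2 mu D (e n)) -> L2 mu D (fun x => \sum_(n < N) c n * e n x).
Proof.
move=> eL; elim: N => [|N IH].
  under eq_fun do rewrite big_ord0; apply/L2P; split; first exact: cmeasurable_cst.
  by apply: eq_integrable (integrable0 _ _) => // x _; rewrite Normc.normc0 expr0n.
by under eq_fun do rewrite big_ord_recr/=; apply: L2D => //; exact: L2Z.
Qed.

Lemma L2norm_fin_num f : L2 mu D f -> L2norm mu D f \is a fin_num.
Proof. by move=> [_ f2]; rewrite ge0_fin_numE// /L2norm Lnorm_ge0. Qed.

(** Cauchy-Schwarz, as the case p = q = 2 of Hoelder's inequality. *)
Lemma integral_normc_mul_le f g : L2 mu D f -> L2 mu D g ->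
  (\int[mu]_(x in D) (normc (f x) * normc (g x))%:E <= L2norm mu D f * L2norm mu D g)%E.
Proof.
move=> [mf f2] [mg g2].
have mT h : cmeasurable_fun D h -> measurable_fun setT ((fun x => normc (h x)) \_ D).
  by move=> mh; apply/(measurable_restrictT _ mD); exact: measurable_normc.
have := @hoelder _ _ _ mu _ _ 2 2 (mT _ mf) (mT _ mg).
rewrite Lnorm1 /L2norm !restrict_EFin => H.
apply: le_trans (H _ _ _); last 3 first.
- by [].
- by [].
- by field.
rewrite integral_mkcond le_eqVlt; apply/orP; left; apply/eqP.
apply: eq_integral => x _ /=.
rewrite /patch; case: ifPn => _; last by rewrite mulr0 normr0.
by rewrite ger0_norm ?mulr_ge0 ?normc_ge0.
Qed.

Lemma inner_integrable f g : L2 mu D f -> L2 mu D g ->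
  mu.-integrable D (EFin \o (fun x => complex.Re (f x * conjc (g x)))) /\
  mu.-integrable D (EFin \o (fun x => complex.Im (f x * conjc (g x)))).
Proof.
move=> Lf Lg; have [mf f2] := Lf; have [mg g2] := Lg.
have [mr mi] := cmeasurable_funM mf (cmeasurable_conj mg).
have int : mu.-integrable D (fun x => (normc (f x) * normc (g x))%:E).
  apply/integrableP; split.
    by apply/measurable_EFinP/measurable_funM; exact: measurable_normc.
  under eq_integral do rewrite gee0_abs ?lee_fin ?mulr_ge0 ?normc_ge0//.
  apply: le_lt_trans (integral_normc_mul_le Lf Lg) _.
  by rewrite ltey_eq fin_numM// L2norm_fin_num.
split; apply: (le_integrable mD _ _ int) => //; try exact/measurable_EFinP.
- move=> x _ /=; rewrite lee_fin (le_trans (ler_Re_normc _))// normcM_conj.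
  by rewrite ger0_norm// mulr_ge0 ?normc_ge0.
- move=> x _ /=; rewrite lee_fin (le_trans (ler_Im_normc _))// normcM_conj.
  by rewrite ger0_norm// mulr_ge0 ?normc_ge0.
Qed.

Lemma inner_le f g : L2 mu D f -> L2 mu D g ->
  `|complex.Re (inner mu D f g)| <= fine (L2norm mu D f) * fine (L2norm mu D g) /\
  `|complex.Im (inner mu D f g)| <= fine (L2norm mu D f) * fine (L2norm mu D g).
Proof.
move=> Lf Lg; have [intr inti] := inner_integrable Lf Lg.
have key (F : T -> R) : mu.-integrable D (EFin \o F) ->
    (forall x, `|F x| <= normc (f x * conjc (g x))) ->
    `|\int[mu]_(x in D) F x| <= fine (L2norm mu D f) * fine (L2norm mu D g).
  move=> intF FE; rewrite -lee_fin EFinM !fineK ?L2norm_fin_num//.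
  rewrite EFin_normr_Rintegral//; apply: le_trans (le_abse_integral _ mD _) _.
    by have /integrableP[] := intF.
  apply: le_trans (integral_normc_mul_le Lf Lg).
  have [[mf _] [mg _]] := (Lf, Lg).
  apply: ge0_le_integral => //.
  - by apply: measurableT_comp => //; have /integrableP[] := intF.
  - by apply/measurable_EFinP/measurable_funM; exact: measurable_normc.
  - by move=> x _; rewrite lee_fin -normcM_conj.
by split; apply: key => // x; [exact: ler_Re_normc|exact: ler_Im_normc].
Qed.

Lemma inner_addl f g h : L2 mu D f -> L2 mu D g -> L2 mu D h ->
  inner mu D (fun x => f x + g x) h = inner mu D f h + inner mu D g h.
Proof.
move=> Lf Lg Lh.
have [fr fi] := inner_integrable Lf Lh; have [gr gi] := inner_integrable Lg Lh.
apply: complex_ext => /=.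
  by rewrite -RintegralD//; apply: eq_Rintegral => x _; rewrite mulrDl Re_add.
by rewrite -RintegralD//; apply: eq_Rintegral => x _; rewrite mulrDl Im_add.
Qed.

Lemma inner_scalel c f g : L2 mu D f -> L2 mu D g ->
  inner mu D (fun x => c * f x) g = c * inner mu D f g.
Proof.
move=> Lf Lg; have [fr fi] := inner_integrable Lf Lg.
have Zr k (F : T -> R) : mu.-integrable D (EFin \o F) ->
    mu.-integrable D (EFin \o (fun x => k * F x)) by exact: integrableZl.
apply: complex_ext; rewrite ?Re_mul ?Im_mul /=.
  rewrite -!RintegralZl// -RintegralB//; try exact: Zr.
  by apply: eq_Rintegral => x _; rewrite -mulrA Re_mul.
rewrite -!RintegralZl// -RintegralD//; try exact: Zr.
by apply: eq_Rintegral => x _; rewrite -mulrA Im_mul.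
Qed.

Lemma inner_conj f g : L2 mu D f -> L2 mu D g ->
  inner mu D g f = conjc (inner mu D f g).
Proof.
move=> Lf Lg; have [fr fi] := inner_integrable Lf Lg.
apply: complex_ext; rewrite ?Re_conj ?Im_conj /=.
  by apply: eq_Rintegral => x _; rewrite !Re_mul !Re_conj !Im_conj; ring.
rewrite -[RHS]mulN1r -RintegralZl//; apply: eq_Rintegral => x _.
by rewrite !Im_mul !Re_conj !Im_conj; ring.
Qed.

Lemma inner_lin_combl (c : nat -> R[i]) (e : nat -> T -> R[i]) g N :
  (forall n, L2 mu D (e n)) -> L2 mu D g ->
  inner mu D (fun x => \sum_(n < N) c n * e n x) g =
  \sum_(n < N) c n * inner mu D (e n) g.
Proof.
move=> eL gL; elim: N => [|N IH].
  rewrite big_ord0; under [X in inner _ _ X _]eq_fun do rewrite big_ord0.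
  by apply: complex_ext => /=; under eq_Rintegral do rewrite mul0r/=;
     rewrite Rintegral_cst// mul0r.
rewrite big_ord_recr/= -IH -inner_scalel// -inner_addl//.
- by under [X in inner _ _ X _]eq_fun do rewrite big_ord_recr/=.
- exact: L2_lin_comb.
- exact: L2Z.
Qed.

Lemma inner_self f : L2 mu D f ->
  complex.Re (inner mu D f f) = fine (L2norm mu D f) ^+ 2.
Proof.
move=> Lf; have L0 : 0 <= fine (L2norm mu D f) by rewrite fine_ge0// /L2norm Lnorm_ge0.
rewrite /= /Rintegral.
have -> : (\int[mu]_(x in D) (complex.Re (f x * conjc (f x)))%:E =
           L2norm mu D f `^ 2)%E.
  rewrite L2norm_sqr; apply: eq_integral => x _.
  by rewrite normc_sqr Re_mul Re_conj Im_conj mulrN opprK -!expr2.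
by rewrite -[in LHS](fineK (L2norm_fin_num Lf)) poweR_EFin/= powR_mulrn.
Qed.

Lemma inner_ae_zero f g : L2 mu D f -> L2 mu D g -> ae_zero mu D f ->
  inner mu D f g = 0.
Proof.
move=> [mf _] [mg _] f0.
have [mr mi] := cmeasurable_funM mf (cmeasurable_conj mg).
have eq0 (F : T -> R) : measurable_fun D F ->
    (forall x, f x = 0 -> F x = 0) -> \int[mu]_(x in D) F x = 0.
  move=> mF F0; rewrite /Rintegral (ae_eq_integral (cst 0%E))//.
  - by rewrite integral0.
  - exact/measurable_EFinP.
  - by apply: filterS f0 => x fx /fx /F0 /= ->.
by apply: complex_ext => /=; apply: eq0 => // x ->; rewrite mul0r.
Qed.

Lemma L2norm0_ae_zero f : L2 mu D f -> fine (L2norm mu D f) = 0 -> ae_zero mu D f.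
Proof.
move=> Lf f0; have [mf _] := Lf.
have mn : measurable_fun D (fun x => (normc (f x))%:E).
  exact/measurable_EFinP/measurable_normc.
have : L2norm mu D f = 0%E by rewrite -(fineK (L2norm_fin_num Lf)) f0.
move/Lnorm_eq0_eq0 => /(_ _ _).
have m' : measurable_fun setT ((fun x => (normc (f x))%:E) \_ D).
  exact/(measurable_restrictT _ mD).
move=> /(_ m' ltac:(by [])) h; apply: filterS h => x /(_ I) + Dx.
rewrite patchE mem_set// => -[]; exact: Normc.eq0_normc.
Qed.

(** * Hilbert bases *)

Section orthonormal.
Variable e : nat -> T -> R[i].
Hypothesis he : hilbert_basis mu D e.

Lemma inner_basis_comb (c : nat -> R[i]) N m : (m < N)%N ->
  inner mu D (fun x => \sum_(n < N) c n * e n x) (e m) = c m.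
Proof.
move=> mN; have [eL eo _] := he; rewrite inner_lin_combl//.
rewrite (bigD1 (Ordinal mN))//= eo eqxx mulr1 big1 ?addr0// => i im.
rewrite eo (_ : (i == m :> nat) = false) ?mulr0//.
by apply: contraNF im => /eqP im; apply/eqP/val_inj.
Qed.

(** The scalar product with e m is continuous for the L2 norm: on the partial
    sums with N > m it equals c m, and in the limit it is the one of f. *)
Lemma hilbert_basis_coeff_eq0 (c : nat -> R[i]) f : L2 mu D f -> ae_zero mu D f ->
  L2norm mu D (fun x => f x - \sum_(n < N) c n * e n x) @[N --> \oo] --> 0%E ->
  forall m, c m = 0.
Proof.
move=> Lf f0 cv m; have [eL eo _] := he.
pose S N x := \sum_(n < N) c n * e n x.
have LS N : L2 mu D (S N) by exact: L2_lin_comb.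
have LN N : L2 mu D (fun x => (-1) * S N x) by exact: L2Z.
have LfS N : L2 mu D (fun x => f x - S N x).
  by under eq_fun do rewrite -mulN1r; exact: L2D.
have innerE N : (m < N)%N -> inner mu D (fun x => f x - S N x) (e m) = - c m.
  move=> mN; under [X in inner _ _ X _]eq_fun do rewrite -mulN1r.
  by rewrite inner_addl// inner_scalel// inner_ae_zero// inner_basis_comb// add0r mulN1r.
set K := fine (L2norm mu D (e m)).
have small (r : R) : (forall N, (m < N)%N ->
    `|r| <= fine (L2norm mu D (fun x => f x - S N x)) * K) -> r = 0.
  move=> rN; apply/eqP; rewrite -normr_le0.
  have : (fine (L2norm mu D (fun x => f x - S N x)) * K) @[N --> \oo] --> 0 * K.
    by apply: cvgM; [exact: fine_cvg cv|exact: cvg_cst].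
  rewrite mul0r => h; rewrite -(cvg_lim _ h)//; apply: limr_ge.
    by apply/cvgP; exact: h.
  by exists m.+1 => // N /=; exact: rN.
have [Kr Ki] : complex.Re (c m) = 0 /\ complex.Im (c m) = 0.
  split; apply: small => N mN; have [hr hi] := inner_le (LfS N) (eL m).
    by move: hr; rewrite innerE// Re_opp normrN.
  by move: hi; rewrite innerE// Im_opp normrN.
exact: complex_ext.
Qed.

(** A combination g of the basis is orthogonal to f, hence the square of the
    norm of f is the scalar product of f - g with f, which density makes at
    most eps times the norm of f. *)
Lemma hilbert_basis_total f : L2 mu D f ->
  (forall n, inner mu D f (e n) = 0) -> ae_zero mu D f.
Proof.
move=> Lf fe0; have [eL eo dense] := he; apply: L2norm0_ae_zero => //.
set K := fine (L2norm mu D f); have K0 : 0 <= K by rewrite fine_ge0// /L2norm Lnorm_ge0.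
apply/eqP; rewrite eq_le K0 andbT.
apply/ler_addgt0Pl => eps eps0; rewrite addr0.
have [N [c cN]] := dense f Lf eps eps0.
set g := fun x => \sum_(n < N) c n * e n x.
have Lg : L2 mu D g by exact: L2_lin_comb.
have LNg : L2 mu D (fun x => (-1) * g x) by exact: L2Z.
have Lfg : L2 mu D (fun x => f x - g x).
  by under eq_fun do rewrite -mulN1r; exact: L2D.
have gf0 : inner mu D g f = 0.
  rewrite inner_lin_combl// big1// => i _.
  by rewrite (inner_conj Lf)// fe0 conjc0 mulr0.
have ffg : inner mu D f f = inner mu D (fun x => f x - g x) f.
  under [X in _ = inner _ _ X _]eq_fun do rewrite -mulN1r.
  by rewrite inner_addl// inner_scalel// gf0 mulr0 addr0.
have [+ _] := inner_le Lfg Lf; rewrite -ffg inner_self// ger0_norm ?exprn_ge0//.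
rewrite -/K expr2.
have := cN; rewrite -(fineK (L2norm_fin_num Lfg)) lte_fin.
move=> lt_eps KK; have [->|Kn0] := eqVneq K 0; first exact: ltW.
have {}K0 : 0 < K by rewrite lt_neqAle eq_sym Kn0.
by move: KK; rewrite ler_pM2r// => /le_trans; apply; exact: ltW.
Qed.

End orthonormal.

End L2_theory.

(** * The Mittag-Leffler function on the imaginary axis *)

Section gamma_growth.
Context {R : realType}.
Implicit Types (a b r x A : R).

Lemma Gamma_ge_div x A : 0 < x -> 0 < A -> A `^ x * expR (- (A + 1)) <= x * Gamma x.
Proof.
move=> x0 A0; apply: le_trans (Gamma_add1_le x0).
have x1 : 1 <= x + 1 by rewrite lerDr ltW.
by have := Gamma_ge x1 A0; rewrite addrK.
Qed.

Lemma natr_le_exp2 n : n%:R <= 2 ^+ n :> R.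
Proof. by rewrite -natrX ler_nat ltnW// ltn_expl. Qed.

Lemma powR_invK x a : 0 < x -> 0 < a -> (x `^ a^-1) `^ a = x.
Proof. by move=> x0 a0; rewrite -powRrM mulVf ?gt_eqF// powRr1// ltW. Qed.

(** With A ^ a = 2 r, the lower bound of x Gamma x, which is proportional to
    A ^ x, absorbs r ^ n and leaves a factor 2 ^ n for the linear term x. *)
Lemma Gamma_coeff_bound a b r : 0 < a -> 0 < b -> 0 < r ->
  exists M, coeff_bound (fun n => (Gamma (a * n%:R + b))^-1) r M.
Proof.
move=> a0 b0 r0; pose A := (2 * r) `^ a^-1; have A0 : 0 < A by rewrite powR_gt0// mulr_gt0.
exists ((a + b) * expR (A + 1) / A `^ b) => n.
have x0 : 0 < a * n%:R + b by rewrite ltr_wpDl// mulr_ge0// ltW.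
have G0 := Gamma_gt0 x0.
rewrite ger0_norm ?invr_ge0 ?(ltW G0)// mulrC ler_pdivrMr//.
have := Gamma_ge_div x0 A0; rewrite expRN ler_pdivrMr ?expR_gt0// => h.
have AE : A `^ (a * n%:R + b) = 2 ^+ n * r ^+ n * A `^ b.
  rewrite powRD; last by rewrite (gt_eqF A0) implybT.
  have Aa : A `^ a = 2 * r by apply: powR_invK => //; rewrite mulr_gt0.
  by rewrite powRrM Aa powR_mulrn ?mulr_ge0 ?(ltW r0)// exprMn.
have Ab0 : 0 < A `^ b by rewrite powR_gt0.
have n2 : a * n%:R + b <= (a + b) * 2 ^+ n.
  rewrite mulrDl lerD// ?ler_wpM2l ?(ltW a0) ?natr_le_exp2//.
  by rewrite ler_peMr ?(ltW b0)// exprn_ege1// ler1n.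
have p2 : (0 : R) < 2 ^+ n by rewrite exprn_gt0.
suff : r ^+ n * A `^ b <= (a + b) * expR (A + 1) * Gamma (a * n%:R + b).
  by rewrite -ler_pdivlMr// mulrAC.
rewrite -(ler_pM2l p2) mulrA -AE (le_trans h)//.
rewrite [leRHS](_ : _ = (a + b) * 2 ^+ n * Gamma (a * n%:R + b) * expR (A + 1)); last by ring.
by rewrite ler_pM2r ?expR_gt0// ler_pM2r.
Qed.

(** The Gamma function outgrows every geometric progression, so its quotients
    along an arithmetic progression of arguments are unbounded. *)
Lemma Gamma_not_geometric a C : 0 < a ->
  ~ (forall k : nat, Gamma (a * k.+1%:R + 1) <= C * Gamma (a * k%:R + 1)).
Proof.
move=> a0 hC.
have G1 : 0 < Gamma (1 : R) by exact: Gamma_gt0.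
have C0 : 0 < C.
  have /(lt_le_trans _) := hC 0%N; rewrite mulr0 add0r => h.
  by rewrite -(pmulr_lgt0 _ G1) h// Gamma_gt0// addr_gt0// mulr_gt0.
have geo k : Gamma (a * k%:R + 1) <= C ^+ k * Gamma 1.
  elim: k => [|k IH]; first by rewrite mulr0 add0r expr0 mul1r.
  by rewrite (le_trans (hC k))// exprS -mulrA ler_pM2l.
pose A := (2 * C) `^ a^-1; have A0 : 0 < A by rewrite powR_gt0// mulr_gt0.
pose B := expR (A + 1) * Gamma 1.
have B0 : 0 < B by rewrite mulr_gt0// expR_gt0.
have bound k : k%:R <= B.
  apply: le_trans (natr_le_exp2 k) _.
  have x1 : 1 <= a * k%:R + 1 by rewrite lerDr mulr_ge0// ltW.
  have := Gamma_ge x1 A0; rewrite addrK => /le_trans /(_ (geo k)).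
  have Aa : A `^ a = 2 * C by apply: powR_invK => //; rewrite mulr_gt0.
  rewrite expRN ler_pdivrMr ?expR_gt0// powRrM Aa powR_mulrn ?mulr_ge0 ?(ltW C0)// exprMn.
  by rewrite mulrC -mulrA ler_pM2l ?exprn_gt0// [Gamma 1 * _]mulrC.
have := truncnS_gt B; rewrite ltNge => /negP; apply; exact: bound.
Qed.

End gamma_growth.

Section complex_limits.
Context {R : realType}.
Implicit Types (u : nat -> R[i]) (a be w x : R) (b : bool) (z : R[i]).

Lemma lim_complex u (a b : R) : complex.Re (u n) @[n --> \oo] --> a ->
  complex.Im (u n) @[n --> \oo] --> b ->
  lim ((u : nat -> (R[i] : numFieldType)) @ \oo) = (a +i* b)%C.
Proof.
move=> ua ub; apply: cvg_lim; first exact: norm_hausdorff.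
apply/cvgrPdist_lt => e e0.
have [Re0 eE] : 0 < complex.Re e /\ e = (complex.Re e)%:C%C.
  by move: e0; case: e => er ei; rewrite ltcE/= => /andP[/eqP -> ->].
have e20 : 0 < complex.Re e / 2 by rewrite divr_gt0.
move/cvgrPdist_lt : ua => /(_ _ e20) na; move/cvgrPdist_lt : ub => /(_ _ e20) nb.
near=> n.
have ha : `|a - complex.Re (u n)| < complex.Re e / 2 by near: n.
have hb : `|b - complex.Im (u n)| < complex.Re e / 2 by near: n.
rewrite normc_def eE ltcR; move: ha hb; case: (u n) => p q /= ha hb.
have /= h := normc_le_normD ((a - p) +i* (b - q))%C.
by apply: le_lt_trans h _; lra.
Unshelve. all: by end_near. Qed.

Definition mi_pow n : R[i] := (- 'i%C) ^+ n.

Lemma normc_mi_pow n : Normc.normc (mi_pow n) = 1.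
Proof.
elim: n => [|n IH]; first by rewrite /mi_pow expr0 Normc.normc1.
rewrite /mi_pow exprS Normc.normcM -/(mi_pow n) IH mulr1.
by rewrite /= oppr0 sqrrN expr0n/= expr1n add0r sqrtr1.
Qed.

(** Indexing the two real coordinates by a boolean lets the identities below
    be proved for both at once. *)
Definition coord (b : bool) (z : R[i]) : R :=
  if b then complex.Im z else complex.Re z.

Lemma coord_le b z : `|coord b z| <= Normc.normc z.
Proof. by case: b; [exact: ler_Im_normc|exact: ler_Re_normc]. Qed.

Lemma coord0 b : coord b 0 = 0.
Proof. by case: b. Qed.

Lemma coord_add b z z' : coord b (z + z') = coord b z + coord b z'.
Proof. by case: b; [exact: Im_add|exact: Re_add]. Qed.

Lemma coord_mulr b z (x : R) : coord b (z * x%:C%C) = coord b z * x.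
Proof. by case: b; rewrite /= ?Im_mul ?Re_mul /= mulr0 ?subr0 ?add0r. Qed.

Lemma mi_series_cvg b a be w : 0 < a -> 0 < be ->
  cvgn (pseries (fun n => coord b (mi_pow n) / Gamma (a * n%:R + be)) w).
Proof.
move=> a0 b0; have r0 : 0 < `|w| + 1 by rewrite ltr_wpDl.
have [M hM] := Gamma_coeff_bound a0 b0 r0.
apply: (coeff_bound_cvg r0 (M := 1 * M)); last by rewrite ltrDl.
apply: coeff_bound_mul (ltW r0) _ hM => n.
by rewrite (le_trans (coord_le _ _))// normc_mi_pow.
Qed.

Lemma mittag_leffler_imag a be w : 0 < a -> 0 < be ->
  mittag_leffler a be (- 'i%C * w%:C%C) =
  (limn (pseries (fun n => coord false (mi_pow n) / Gamma (a * n%:R + be)) w) +i*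
   limn (pseries (fun n => coord true (mi_pow n) / Gamma (a * n%:R + be)) w))%C.
Proof.
move=> a0 b0.
have termE n : (- 'i%C * w%:C%C) ^+ n / (Gamma (a * n%:R + be))%:C%C =
    mi_pow n * (w ^+ n / Gamma (a * n%:R + be))%:C%C.
  by rewrite exprMn -/(mi_pow n) -mulrA rmorphM/= rmorphXn fmorphV.
have sumE b : (fun N => coord b
      (series (fun n => (- 'i%C * w%:C%C) ^+ n / (Gamma (a * n%:R + be))%:C%C) N)) =
    pseries (fun n => coord b (mi_pow n) / Gamma (a * n%:R + be)) w.
  apply/funext => N; rewrite /pseries /series/=.
  rewrite (big_morph _ (coord_add b) (coord0 b)).
  by apply: eq_bigr => n _; rewrite termE coord_mulr mulrAC -mulrA.
have cv b : (fun N => coord b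
      (series (fun n => (- 'i%C * w%:C%C) ^+ n / (Gamma (a * n%:R + be))%:C%C) N)) @ \oo -->
    limn (pseries (fun n => coord b (mi_pow n) / Gamma (a * n%:R + be)) w).
  by rewrite sumE; exact: mi_series_cvg.
exact: (lim_complex (cv false) (cv true)).
Qed.

(** On the imaginary axis the coordinates of the Mittag-Leffler function are
    real power series, so that those of its product with a constant are too. *)
Lemma coord_mul_mittag_leffler b a be w z : 0 < a -> 0 < be ->
  coord b (z * mittag_leffler a be (- 'i%C * w%:C%C)) =
  limn (pseries (fun n => coord b (z * mi_pow n) / Gamma (a * n%:R + be)) w).
Proof.
move=> a0 b0; rewrite mittag_leffler_imag//.
have cRe := @mi_series_cvg false a be w a0 b0.
have cIm := @mi_series_cvg true a be w a0 b0.
case: b; rewrite /= ?Im_mul ?Re_mul /=.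
- rewrite -lim_pseries_comb//; congr (limn (pseries _ _)); apply/funext => n.
  by rewrite /= Im_mul; ring.
- rewrite -mulNr -lim_pseries_comb//; congr (limn (pseries _ _)); apply/funext => n.
  by rewrite /= Re_mul; ring.
Qed.

End complex_limits.

(** * Convolution of the fractional kernel with a power series *)

Section kernel.
Context {R : realType}.
Notation mu := (@lebesgue_measure R).
Variables (T : R).
Hypothesis T0 : 0 < T.
Implicit Types (p x s : R).
Local Notation D := (`]0, T[%classic : set (measurableTypeR R)).

Lemma measurable_kernel p (A : set R) : measurable A ->
  measurable_fun A (fun s => (T - s) `^ p).
Proof.
move=> mA; apply: (measurableT_comp (measurable_powR p)).
by apply: measurable_funB; [exact: measurable_cst|exact: measurable_id].
Qed.

(** The kernel is singular at T when p < 1; the bound comes from the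
    intervals [0, T - T / (n + 2)]. *)
Lemma kernel_integral_le p : 0 < p ->
  (\int[mu]_(s in D) ((T - s) `^ (p - 1))%:E <= (T `^ p / p)%:E)%E.
Proof.
move=> p0; pose b n := T - T / n.+2%:R.
pose I n := `[0, b n]%classic.
have n1 n : (1 : R) < n.+2%:R by rewrite (ltr_nat R 1 n.+2).
have b0 n : 0 < b n.
  by rewrite subr_gt0 ltr_pdivrMr ?(lt_trans ltr01)// ltr_pMr.
have bT n : b n < T by rewrite gtrBl divr_gt0.
have int n : (\int[mu]_(s in I n) ((T - s) `^ (p - 1))%:E <= (T `^ p / p)%:E)%E.
  have sub0 s : s \in `[0, b n] -> 0 < T - s.
    by rewrite in_itv/= subr_gt0 => /andP[_ /le_lt_trans]; exact.
  have dF s : s \in `[0, b n] ->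
      is_derive s 1 (fun s => - ((T - s) `^ p / p)) ((T - s) `^ (p - 1)).
    move=> /sub0 s0; have := is_derive1_powR p s0 => dP.
    have dT : is_derive s 1 (fun s => T - s) (- 1).
      by apply: is_derive_eq; rewrite add0r mul1r.
    have dC : is_derive s 1 (fun s => (T - s) `^ p) ((p * (T - s) `^ (p - 1)) * - 1).
      exact: (@is_derive1_comp R (fun x => x `^ p) (fun s => T - s) s _ _ dP dT).
    apply: is_derive_eq; rewrite /GRing.scale/=; field.
    by rewrite gt_eqF.
  have cf s : s \in `[0, b n] -> {for s, continuous (fun s => (T - s) `^ (p - 1))}.
    move=> /sub0 s0; have := is_derive1_powR (p - 1) s0 => -[dP _].
    apply: (@continuous_comp _ _ _ (fun s => T - s) (fun x => x `^ (p - 1))).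
      by apply: cvgB; [exact: cvg_cst|exact: cvg_id].
    exact/differentiable_continuous/derivable1_diffP.
  rewrite (is_derive_FTC2 (b0 n) dF cf) lee_fin subr0 opprK addrC gerBl.
  by rewrite divr_ge0 ?powR_ge0// ltW.
have ndI : nondecreasing_seq I.
  move=> m n mn; rewrite subsetEset => s; rewrite /I/= !in_itv/= => /andP[-> sb].
  rewrite (le_trans sb)// /b lerD2l lerN2 ler_pM2l// lef_pV2 ?posrE//.
  by rewrite ler_nat.
apply: (@le_trans _ _ (\int[mu]_(s in \bigcup_n I n) ((T - s) `^ (p - 1))%:E)%E).
  apply: ge0_subset_integral => //.
  - by apply: bigcupT_measurable => n; exact: measurable_itv.
  - apply/measurable_EFinP; apply: measurable_kernel.
    by apply: bigcupT_measurable => n; exact: measurable_itv.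
  - by move=> s _; rewrite lee_fin powR_ge0.
  - move=> s; rewrite /= in_itv/= => /andP[s0 sT].
    have Ts : 0 < T - s by rewrite subr_gt0.
    exists (Num.truncn (T / (T - s))) => //; rewrite /I/= in_itv/= (ltW s0)/=.
    set k := Num.truncn _; have : T / (T - s) < k.+2%:R.
      by apply: lt_le_trans (truncnS_gt _) _; rewrite ler_nat.
    rewrite ltr_pdivrMr// => h.
    have k0 : (0 : R) < k.+2%:R by rewrite (lt_trans ltr01).
    have : T / k.+2%:R <= T - s by rewrite ler_pdivrMr// mulrC ltW.
    by rewrite /b lerBrDr addrC -lerBrDr.
have cv : (\int[mu]_(s in I n) ((T - s) `^ (p - 1))%:E @[n --> \oo] -->
    \int[mu]_(s in \bigcup_n I n) ((T - s) `^ (p - 1))%:E)%E.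
  apply: ge0_nondecreasing_set_cvg_integral => //.
  - by move=> n; exact: measurable_itv.
  - by move=> n; apply/measurable_EFinP; apply: measurable_kernel; exact: measurable_itv.
  - by move=> n s _; rewrite lee_fin powR_ge0.
rewrite -(cvg_lim _ cv)//; apply: lime_le; first by apply/cvgP; exact: cv.
by apply: nearW => n; exact: int.
Qed.

Lemma kernel_integrable p : 0 < p ->
  mu.-integrable D (EFin \o (fun s => (T - s) `^ (p - 1))).
Proof.
move=> p0; apply/integrableP; split.
  by apply/measurable_EFinP; apply: measurable_kernel.
under eq_integral do rewrite /= ger0_norm ?powR_ge0//.
exact: le_lt_trans (kernel_integral_le p0) (ltry _).
Qed.

Lemma kernel_scale_integrable k p : 0 < p ->
  mu.-integrable D (EFin \o (fun s => k * (T - s) `^ (p - 1))).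
Proof. by move=> p0; exact: integrableZl (kernel_integrable p0). Qed.

Section moments.
Variables (alpha K : R) (v : nat -> R -> R) (q : nat -> R).
Hypothesis alpha0 : 0 < alpha.
Hypothesis mv : forall k, measurable_fun (setT : set (measurableTypeR R)) (v k).
Hypothesis vK : forall k s, `|v k s| <= K.
Hypothesis hq : forall r, 0 < r -> exists M, coeff_bound q r M.

Definition kernel_moment k :=
  \int[mu]_(s in D) ((T - s) `^ (alpha * k.+1%:R - 1) * v k s).

Let p_gt0 k : 0 < alpha * k.+1%:R. Proof. by rewrite mulr_gt0. Qed.

Let K0 : 0 <= K. Proof. exact: le_trans (vK 0 0). Qed.

Lemma kernel_moment_integrable k : mu.-integrable D
  (EFin \o (fun s => (T - s) `^ (alpha * k.+1%:R - 1) * v k s)).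
Proof.
apply: le_integrable (kernel_scale_integrable K (p_gt0 k)) => //.
  apply/measurable_EFinP; apply: measurable_funM; first exact: measurable_kernel.
  exact: measurable_funTS.
move=> s _; rewrite /= lee_fin !normrM mulrC.
by rewrite ler_wpM2r// (le_trans (vK _ _))// ler_norm.
Qed.

Lemma kernel_moment_le k : `|kernel_moment k| <=
  K * (T `^ (alpha * k.+1%:R) / (alpha * k.+1%:R)).
Proof.
have KI := kernel_scale_integrable K (p_gt0 k).
apply: le_trans (le_normr_Rintegral _ (kernel_moment_integrable k)) _ => //.
apply: (@le_trans _ _ (\int[mu]_(s in D) (K * (T - s) `^ (alpha * k.+1%:R - 1)))).
  apply: le_Rintegral => //.
    have := integrable_abse (kernel_moment_integrable k).
    by apply: eq_integrable.
  move=> s _; rewrite normrM (ger0_norm (powR_ge0 _ _)) mulrC.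
  by rewrite ler_wpM2r ?powR_ge0.
rewrite RintegralZl//; last exact: kernel_integrable.
rewrite ler_wpM2l// -lee_fin /Rintegral fineK; first exact: kernel_integral_le.
by apply: integrable_fin_num => //; exact: kernel_integrable.
Qed.

Let w x s := x * (T - s) `^ alpha.
Let kser x s := pseries (fun k => v k s * q k) (w x s).

Let w_le x s : D s -> `|w x s| <= `|x| * T `^ alpha.
Proof.
rewrite /= in_itv/= => /andP[s0 sT]; rewrite /w normrM ler_wpM2l//.
rewrite ger0_norm ?powR_ge0// ge0_ler_powR ?nnegrE ?subr_ge0 ?(ltW sT) ?(ltW alpha0) ?(ltW T0)//.
by rewrite gerBl ltW.
Qed.

Lemma kernel_series_measurable x :
  measurable_fun D (fun s => (T - s) `^ (alpha - 1) * limn (kser x s)) /\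
  (forall N, measurable_fun D (fun s => (T - s) `^ (alpha - 1) * kser x s N)) /\
  forall s, D s -> cvgn (kser x s).
Proof.
have r0 : 0 < `|x| * T `^ alpha + 1 by rewrite ltr_wpDl ?mulr_ge0 ?powR_ge0.
have [M hM] := hq r0.
have cb s : coeff_bound (fun k => v k s * q k) (`|x| * T `^ alpha + 1) (K * M).
  by apply: coeff_bound_mul (ltW r0) _ hM => n; exact: vK.
have cv s : D s -> cvgn (kser x s).
  move=> Ds; apply: (coeff_bound_cvg r0 (cb s)).
  by apply: (le_lt_trans (w_le x Ds)); rewrite ltrDl.
have mser N : measurable_fun D (fun s => kser x s N).
  rewrite /kser /pseries /series/=; apply: measurable_sum => k.
  apply: measurable_funM; first apply: measurable_funM.
  - exact: measurable_funTS.
  - exact: measurable_cst.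
  - apply: (measurable_funX k); apply: measurable_funM; first exact: measurable_cst.
    exact: measurable_kernel.
split; last split => // N; last first.
  by apply: measurable_funM => //; exact: measurable_kernel.
apply: measurable_funM; first exact: measurable_kernel.
by apply: (measurable_fun_cvg mser) => s Ds; exact: cv.
Qed.

Lemma kernel_powR k s : D s ->
  (T - s) `^ (alpha - 1) * ((T - s) `^ alpha) ^+ k = (T - s) `^ (alpha * k.+1%:R - 1).
Proof.
rewrite /= in_itv/= => /andP[_ sT]; have Ts : 0 < T - s by rewrite subr_gt0.
rewrite -powR_mulrn ?powR_ge0// -powRrM -powRD; last by rewrite (gt_eqF Ts) implybT.
by rewrite -natr1 mulrDr mulr1; congr (_ `^ _); ring.
Qed.

(** Term by term integration by dominated convergence: the partial sums are
    bounded uniformly in s, and the kernel (T - s) ^ (alpha - 1) is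
    integrable. *)
Lemma integral_kernel_series x :
  \int[mu]_(s in D) ((T - s) `^ (alpha - 1) * limn (kser x s)) =
  limn (pseries (fun k => kernel_moment k * q k) x).
Proof.
have [mlim [mpart cv]] := kernel_series_measurable x.
pose r := 2 * (`|x| * T `^ alpha) + 1.
have xT0 : 0 <= `|x| * T `^ alpha by rewrite mulr_ge0 ?powR_ge0.
have r0 : 0 < r by rewrite /r; lra.
have [M hM] := hq r0.
have cb s : coeff_bound (fun k => v k s * q k) r (K * M).
  by apply: coeff_bound_mul (ltW r0) _ hM => n; exact: vK.
pose f_ N s := ((T - s) `^ (alpha - 1) * kser x s N)%:E.
pose f s := ((T - s) `^ (alpha - 1) * limn (kser x s))%:E.
pose g s := ((2 * (K * M)) * (T - s) `^ (alpha - 1))%:E.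
have ff s : D s -> f_ N s @[N --> \oo] --> f s.
  move=> Ds; apply: cvg_EFin; first exact: nearW.
  by apply: cvgM; [exact: cvg_cst|exact: cv].
have fg s N : D s -> (`|f_ N s| <= g s)%E.
  move=> Ds; rewrite /f_ /g /= lee_fin normrM (ger0_norm (powR_ge0 _ _)) mulrC.
  rewrite ler_wpM2r ?powR_ge0// (coeff_bound_partial_le N r0 (cb s))//.
  by rewrite /r (le_trans (w_le x Ds))//; lra.
have [||||||fint _ fcv] := @dominated_convergence _ _ _ mu D _ f_ f g.
- by [].
- by move=> N; exact/measurable_EFinP.
- exact/measurable_EFinP.
- by apply: aeW => s Ds; exact: ff.
- exact: kernel_scale_integrable.
- by apply: aeW => s N Ds; exact: fg.
have f_int N : mu.-integrable D (f_ N).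
  apply: le_integrable (kernel_scale_integrable (2 * (K * M)) alpha0) => //.
    exact/measurable_EFinP.
  by move=> s Ds; apply: le_trans (fg s N Ds) _; rewrite lee_fin ler_norm.
have term_int N : mu.-integrable D (fun s =>
    ((x ^+ N * q N) * ((T - s) `^ (alpha * N.+1%:R - 1) * v N s))%:E).
  exact: integrableZl (kernel_moment_integrable N).
have f_E N : (\int[mu]_(s in D) f_ N s =
    (pseries (fun k => kernel_moment k * q k) x N)%:E)%E.
  elim: N => [|N IH].
    by rewrite pseries0 integral0_eq// => s _; rewrite /f_ /kser pseries0 mulr0.
  rewrite pseries_recr EFinD -IH.
  have -> : ((kernel_moment N * q N * x ^+ N)%:E = \int[mu]_(s in D)
      ((x ^+ N * q N) * ((T - s) `^ (alpha * N.+1%:R - 1) * v N s))%:E)%E.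
    rewrite -(fineK (integrable_fin_num _ (term_int N)))//; congr EFin.
    rewrite -/(Rintegral mu D (fun s => (x ^+ N * q N) * _)) RintegralZl//.
      by rewrite /kernel_moment; ring.
    exact: kernel_moment_integrable.
  rewrite -integralD//; apply: eq_integral => s /set_mem Ds.
  rewrite -EFinD; congr EFin; rewrite /kser pseries_recr mulrDr.
  congr (_ + _); rewrite -(kernel_powR N Ds) /w exprMn; ring.
have : (fun N => (pseries (fun k => kernel_moment k * q k) x N)%:E) @ \oo -->
    (\int[mu]_(s in D) ((T - s) `^ (alpha - 1) * limn (kser x s)))%:E.
  rewrite /Rintegral fineK; last by apply: integrable_fin_num.
  by under eq_fun do rewrite -f_E.
by move=> /fine_cvg /cvg_lim <-.
Qed.

End moments.
End kernel.

(** * Coefficients of a mode as a power series in the parameter *)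

Section mode_coefficients.
Context {R : realType}.
Variables (alpha T : R) (c : R[i]) (h : R -> R[i]) (K : R).
Hypotheses (alpha0 : 0 < alpha) (T0 : 0 < T).
Hypothesis mh : cmeasurable_fun (setT : set (measurableTypeR R)) h.
Hypothesis hK : forall s, Normc.normc (h s) <= K.
Implicit Types (b : bool) (k : nat) (x r : R).

Definition source_coord b k s := coord b (h s * mi_pow k).

Definition initial_coeff b k :=
  coord b (c * mi_pow k) / Gamma (alpha * k%:R + 1) * (T `^ alpha) ^+ k.

Definition source_coeff b k :=
  kernel_moment T alpha (source_coord b) k / Gamma (alpha * k%:R + alpha).

Definition mode_coeff b k := initial_coeff b k + source_coeff b k.

Lemma source_coord_le b k s : `|source_coord b k s| <= K.
Proof.
by rewrite (le_trans (coord_le _ _))// Normc.normcM normc_mi_pow mulr1.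
Qed.

Lemma measurable_source_coord b k :
  measurable_fun (setT : set (measurableTypeR R)) (source_coord b k).
Proof.
have [mr mi] : cmeasurable_fun (setT : set (measurableTypeR R)) (fun s => h s * mi_pow k).
  by apply: cmeasurable_funM => //; exact: cmeasurable_cst.
by case: b.
Qed.

Let moment_le b k : `|kernel_moment T alpha (source_coord b) k| <=
  K * (T `^ (alpha * k.+1%:R) / (alpha * k.+1%:R)).
Proof.
by apply: kernel_moment_le => //; [exact: measurable_source_coord|exact: source_coord_le].
Qed.

Let Ta0 : 0 < T `^ alpha. Proof. exact: powR_gt0. Qed.

Let K0 : 0 <= K. Proof. exact: le_trans (normc_ge0 _) (hK 0). Qed.

Let powR_TS k : T `^ (alpha * k.+1%:R) = T `^ alpha * (T `^ alpha) ^+ k.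
Proof. by rewrite powRrM powR_mulrn ?powR_ge0// exprS. Qed.

Lemma initial_coeff_bound b r : 0 < r -> exists M, coeff_bound (initial_coeff b) r M.
Proof.
move=> r0; have Tr0 : 0 < T `^ alpha * r by rewrite mulr_gt0.
have [M hM] := Gamma_coeff_bound alpha0 (ltr01 : 0 < 1 :> R) Tr0.
exists (Normc.normc c * M).
apply: coeff_bound_scale (ltW Ta0) _; apply: coeff_bound_mul (ltW Tr0) _ hM => k.
by rewrite (le_trans (coord_le _ _))// Normc.normcM normc_mi_pow mulr1.
Qed.

Lemma source_coeff_bound b r : 0 < r -> exists M, coeff_bound (source_coeff b) r M.
Proof.
move=> r0; have Tr0 : 0 < T `^ alpha * r by rewrite mulr_gt0.
have [M hM] := Gamma_coeff_bound alpha0 alpha0 Tr0.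
exists (K * (T `^ alpha / alpha) * M).
have -> : source_coeff b =
    (fun k => kernel_moment T alpha (source_coord b) k / (T `^ alpha) ^+ k /
       Gamma (alpha * k%:R + alpha) * (T `^ alpha) ^+ k).
  apply/funext => k; rewrite /source_coeff [RHS]mulrAC divfK//.
  by rewrite expf_neq0// gt_eqF.
apply: coeff_bound_scale (ltW Ta0) _; apply: coeff_bound_mul (ltW Tr0) _ hM => k.
rewrite normrM normfV (ger0_norm (exprn_ge0 _ (ltW Ta0))) ler_pdivrMr ?exprn_gt0//.
rewrite (le_trans (moment_le b k))// powR_TS -!mulrA ler_wpM2l// ler_wpM2l ?(ltW Ta0)//.
rewrite mulrC ler_wpM2r ?exprn_ge0 ?(ltW Ta0)//.
by rewrite lef_pV2 ?posrE ?mulr_gt0// ler_peMr ?ler1n// ltW.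
Qed.

Lemma mode_coeff_bound b r : 0 < r -> exists M, coeff_bound (mode_coeff b) r M.
Proof.
move=> r0; have [M hM] := initial_coeff_bound b r0.
have [M' hM'] := source_coeff_bound b r0.
by exists (M + M'); exact: (coeff_bound_add (ltW r0) hM hM').
Qed.

(** Up to the factor T ^ (alpha k), the datum contributes to the k-th
    coefficient a term of size |c| / Gamma (alpha k + 1). The moment of the
    source is O (1 / p) with p = alpha (k + 1), so the source contributes at
    most a constant over p Gamma p, hence over Gamma (p + 1): it decays too
    fast to compensate the datum for every k. *)
Lemma mode_coeff_eq0 : (forall b k, mode_coeff b k = 0) -> c = 0.
Proof.
move=> coef0; apply: contrapT => c0.
have nc0 : 0 < Normc.normc c.
  rewrite lt_neqAle normc_ge0 andbT eq_sym; apply/eqP => /Normc.eq0_normc.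
  exact: c0.
apply: (@Gamma_not_geometric R alpha (2 * K * T `^ alpha / Normc.normc c)) => // k.
have p0 : 0 < alpha * k.+1%:R by rewrite mulr_gt0.
have pE : alpha * k%:R + alpha = alpha * k.+1%:R by rewrite -natr1 mulrDr mulr1.
have G1 : 0 < Gamma (alpha * k%:R + 1) by rewrite Gamma_gt0// ltr_wpDl// mulr_ge0// ltW.
have Gp : 0 < Gamma (alpha * k.+1%:R) by exact: Gamma_gt0.
have Tk0 : 0 < (T `^ alpha) ^+ k by rewrite exprn_gt0.
have bound b : `|coord b (c * mi_pow k)| * (alpha * k.+1%:R * Gamma (alpha * k.+1%:R)) <=
    K * T `^ alpha * Gamma (alpha * k%:R + 1).
  have /eqP := coef0 b k; rewrite /mode_coeff /initial_coeff /source_coeff pE addr_eq0 => /eqP.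
  move/(congr1 (fun x => `|x|)).
  rewrite normrN !normrM !normfV (gtr0_norm Gp) (gtr0_norm G1) (gtr0_norm Tk0) => E.
  have := moment_le b k; rewrite powR_TS => mle.
  have : `|coord b (c * mi_pow k)| / Gamma (alpha * k%:R + 1) * (T `^ alpha) ^+ k <=
      K * (T `^ alpha * (T `^ alpha) ^+ k / (alpha * k.+1%:R)) / Gamma (alpha * k.+1%:R).
    by rewrite E ler_wpM2r// invr_ge0 ltW.
  set X := `|_|; set q := alpha * k.+1%:R; set t := (T `^ alpha) ^+ k => ineq.
  have pos : 0 < t / (Gamma (alpha * k%:R + 1) * (q * Gamma q)).
    exact: divr_gt0 Tk0 (mulr_gt0 G1 (mulr_gt0 p0 Gp)).
  rewrite -(ler_pM2r pos); have := ineq.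
  have -> : X * (q * Gamma q) * (t / (Gamma (alpha * k%:R + 1) * (q * Gamma q))) =
      X / Gamma (alpha * k%:R + 1) * t by field; rewrite ?(gt_eqF G1) ?(gt_eqF Gp) ?(gt_eqF p0).
  move=> /le_trans; apply; rewrite le_eqVlt; apply/orP; left; apply/eqP.
  by field; rewrite ?(gt_eqF G1) ?(gt_eqF Gp) ?(gt_eqF p0).
have c_le : Normc.normc c <= `|coord false (c * mi_pow k)| + `|coord true (c * mi_pow k)|.
  apply: le_trans (normc_le_normD (c * mi_pow k)).
  by rewrite Normc.normcM normc_mi_pow mulr1.
rewrite (le_trans (Gamma_add1_le p0))//.
rewrite [leRHS]mulrAC ler_pdivlMr// [leLHS]mulrC.
have q0 : 0 <= alpha * k.+1%:R * Gamma (alpha * k.+1%:R) by rewrite mulr_ge0// ltW.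
apply: (le_trans (ler_wpM2r q0 c_le)); rewrite mulrDl.
apply: (le_trans (lerD (bound false) (bound true))).
by rewrite le_eqVlt; apply/orP; left; apply/eqP; ring.
Qed.

(** Substituting s in the fractional kernel turns the n-th term of the
    Mittag-Leffler series into a power of T - s, whence the moments. *)
Lemma mode_coeff_series b x :
  coord b (c * mittag_leffler alpha 1 (- 'i%C * (x * T `^ alpha)%:C%C)) +
  \int[lebesgue_measure]_(s in `]0, T[) ((T - s) `^ (alpha - 1) *
    coord b (h s * mittag_leffler alpha alpha (- 'i%C * (x * (T - s) `^ alpha)%:C%C))) =
  limn (pseries (mode_coeff b) x).
Proof.
have hq r : 0 < r -> exists M,
    coeff_bound (fun k => (Gamma (alpha * k%:R + alpha))^-1) r M.
  exact: Gamma_coeff_bound.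
transitivity (limn (pseries (initial_coeff b) x) + limn (pseries (source_coeff b) x)).
  congr (_ + _).
    apply: etrans (@coord_mul_mittag_leffler R b alpha 1 _ c alpha0 ltr01) _.
    by rewrite pseries_scale.
  apply: etrans (@integral_kernel_series R T T0 alpha K (source_coord b)
    (fun k => (Gamma (alpha * k%:R + alpha))^-1) alpha0 (measurable_source_coord b)
    (source_coord_le b) hq x).
  apply: eq_Rintegral => s _; congr (_ * _).
  exact: (@coord_mul_mittag_leffler R b alpha alpha _ (h s) alpha0 alpha0).
have x0 : 0 < `|x| + 1 by rewrite ltr_wpDl.
have x1 : `|x| < `|x| + 1 by rewrite ltrDl.
have [M hM] := initial_coeff_bound b x0; have [M' hM'] := source_coeff_bound b x0.
have := lim_pseries_comb 1 1 (coeff_bound_cvg x0 hM x1) (coeff_bound_cvg x0 hM' x1).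
rewrite !mul1r /mode_coeff => <-; congr (limn (pseries _ _)).
by apply/funext => k; rewrite !mul1r.
Qed.

End mode_coefficients.

(** * Completed measures *)

Section transfer.
Context {d1 d2 : measure_display} {X : measurableType d1} {Y : measurableType d2}
  {R : realType}.
Variables (nu : {measure set X -> \bar R}) (mu : {measure set Y -> \bar R})
  (phi : X -> Y).
Hypothesis mphi : measurable_fun setT phi.
Hypothesis nu_mu : forall A, measurable A -> nu (phi @^-1` A) = mu A.
Hypothesis nu_complete : measure_is_complete nu.

Lemma negligible_preimage A : mu.-negligible A -> nu.-negligible (phi @^-1` A).
Proof.
move=> [B [mB B0 AB]]; exists (phi @^-1` B); split.
- by rewrite -[X in measurable X]setTI; exact: mphi.
- by rewrite nu_mu.
- by move=> x /AB.
Qed.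

(** Meant for the identity phi from a completed space to the original one:
    completeness makes f measurable, since it agrees almost everywhere with
    the measurable function F o phi. *)
Lemma integral_transfer (D N : set Y) (f : X -> R) (F : Y -> R) :
  measurable D -> measurable_fun D F -> mu.-negligible N ->
  (forall x, D (phi x) -> ~ N (phi x) -> f x = F (phi x)) ->
  (\int[nu]_(x in phi @^-1` D) (f x)%:E = \int[mu]_(y in D) (F y)%:E)%E.
Proof.
move=> mD mF negN fF.
have mDphi : measurable (phi @^-1` D).
  by rewrite -[X in measurable X]setTI; exact: mphi.
have mFphi : measurable_fun (phi @^-1` D) (fun x => (F (phi x))%:E).
  apply/measurable_EFinP; apply: (measurable_comp mD _ mF) => [_ [x Dx <-]//|].
  exact: measurable_funTS.
have ae : ae_eq nu (phi @^-1` D) (fun x => (F (phi x))%:E) (EFin \o f).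
  apply: negligibleS (negligible_preimage negN) => x /= /not_implyP[Dx nfF].
  by apply: contrapT => /(fF _ Dx) fE; apply: nfF; rewrite /= fE.
have mf : measurable_fun (phi @^-1` D) (EFin \o f).
  exact: (ae_measurable_fun nu_complete ae).
rewrite -(ae_eq_integral _ _ mDphi mFphi mf ae).
have ge0E (G : Y -> \bar R) : measurable_fun D G -> (forall y, 0 <= G y)%E ->
    (\int[nu]_(x in phi @^-1` D) G (phi x) = \int[mu]_(y in D) G y)%E.
  move=> mG G0; rewrite -(@ge0_integral_pushforward _ _ _ _ _ _ mphi)//.
  apply: eq_measure_integral => A mA _; exact: nu_mu.
have mFE : measurable_fun D (EFin \o F) by exact/measurable_EFinP.
rewrite integralE [RHS]integralE -!ge0E//.
- by congr (_ - _)%E; apply: eq_integral => x _; rewrite ?funeposE ?funenegE.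
- exact: measurable_funeneg.
- exact: measurable_funepos.
Qed.

End transfer.

Section completion.
Context {disp : measure_display} {T : measurableType disp} {R : realType}.
Variable mu : {measure set T -> \bar R}.
Hypothesis sfmu : sigma_finite setT mu.
Local Notation cT := (caratheodory_type (mu^*)%mu).
Local Notation cmu := (@completed_measure_extension _ _ _ mu).

Lemma completion_complete : measure_is_complete cmu.
Proof. exact: measure_is_complete_caratheodory. Qed.

Lemma completionE (A : set T) : measurable A -> cmu A = mu A.
Proof. exact: measurable_mu_extE. Qed.

Lemma measurable_completion (A : set T) : measurable A -> measurable (A : set cT).
Proof. exact: caratheodory_measurable_mu_ext. Qed.

Lemma measurable_fun_completion : measurable_fun setT (id : cT -> T).
Proof. by move=> _ A mA; rewrite setTI; exact: measurable_completion. Qed.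

Lemma integral_completion (D N : set T) (f F : T -> R) :
  measurable D -> measurable_fun D F -> mu.-negligible N ->
  (forall x, D x -> ~ N x -> f x = F x) ->
  (\int[cmu]_(x in D) (f x)%:E = \int[mu]_(x in D) (F x)%:E)%E.
Proof.
move=> mD mF negN fF.
apply: (integral_transfer measurable_fun_completion _ completion_complete mD mF negN) => //.
by move=> A mA; exact: completionE.
Qed.

Local Open Scope ereal_scope.

(** The hull is the intersection of a sequence of covers of almost minimal
    measure. *)
Lemma measurable_hull (A : set T) : (mu^*)%mu A < +oo ->
  exists B, [/\ measurable B, A `<=` B & mu B = (mu^*)%mu A].
Proof.
move=> Aoo.
have Afin : (mu^*)%mu A \is a fin_num by rewrite ge0_fin_numE// outer_measure_ge0.
have coverA n : exists B, [/\ measurable B, A `<=` B &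
    mu B <= (mu^*)%mu A + (n.+1%:R^-1)%:E].
  have n0 : (0 < n.+1%:R^-1 :> R)%R by rewrite invr_gt0.
  have [_/= [F [mF AF] <-] lt] := lb_ereal_inf_adherent n0 Afin.
  exists (\bigcup_k F k); split => //; first exact: bigcupT_measurable.
  apply: le_trans (ltW lt); apply: measure_sigma_subadditive => //.
  exact: bigcupT_measurable.
have /choice[B hB] := coverA.
have mB : measurable (\bigcap_n B n).
  by apply: bigcapT_measurable => n; have [] := hB n.
exists (\bigcap_n B n); split => //; first by move=> x Ax n _; have [_ AB _] := hB n; exact: AB.
apply/eqP; rewrite eq_le; apply/andP; split.
  apply/lee_addgt0Pr => e e0.
  have [n _ /(_ n (leqnn n)) ne] := near_infty_natSinv_lt (PosNum e0).
  have [mBn _ Bn] := hB n.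
  apply: (@le_trans _ _ (mu (B n))).
    by apply: le_measure; rewrite ?inE//; exact: bigcap_inf.
  by apply: le_trans Bn _; rewrite leeD2l// lee_fin ltW.
rewrite -(measurable_mu_extE _ mB) le_outer_measure// => x Ax n _.
by have [_ AB _] := hB n; exact: AB.
Qed.

Lemma completion_null_hull (A : set T) : (mu^*)%mu A = 0 -> mu.-negligible A.
Proof.
move=> A0; have [|B [mB AB B0]] := @measurable_hull A; first by rewrite A0.
by exists B; split => //; rewrite B0.
Qed.

Lemma completion_negligible (A : set T) : cmu.-negligible A -> mu.-negligible A.
Proof.
move=> [B [mB B0 AB]]; have := completion_null_hull (B0 : (mu^*)%mu B = 0).
exact: (negligibleS (AB : (A : set T) `<=` B)).
Qed.

Lemma negligible_completion (A : set T) : mu.-negligible A -> measurable (A : set cT).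
Proof.
move=> negA; apply: completion_complete; apply: (@negligible_preimage _ _ _ _ _ cmu mu (id : cT -> T)) => //.
- exact: measurable_fun_completion.
- by move=> B mB; exact: completionE.
Qed.

(** When A has finite measure and H is a measurable hull of A, the difference
    H \ A is null, so A and H agree off a measurable null set; the general
    case follows by sigma-finiteness. *)
Lemma completion_core (A : set T) : measurable (A : set cT) ->
  exists N, [/\ measurable N, mu N = 0 & measurable (A `\` N)].
Proof.
have [F TF mF] := sfmu.
have fin (B : set T) : measurable (B : set cT) -> (mu^*)%mu B < +oo ->
    exists N, [/\ measurable N, mu N = 0 & measurable (B `\` N)].
  move=> cB Boo; have [H [mH BH HB]] := measurable_hull Boo.
  have HB0 : (mu^*)%mu (H `\` B) = 0.
    have : (mu^*)%mu H = (mu^*)%mu (H `&` B) + (mu^*)%mu (H `&` ~` B) := cB H.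
    rewrite (setIidr BH) (measurable_mu_extE _ mH) HB setDE.
    have Bfin : (mu^*)%mu B \is a fin_num by rewrite ge0_fin_numE// outer_measure_ge0.
    by move: Bfin; case: (_ B) => [b| |]// _; case: (_ (_ `&` _)) => [z| |]//= [bz];
      congr EFin; lra.
  have [N [mN N0 HBN]] := completion_null_hull HB0.
  exists N; split => //; suff -> : B `\` N = H `\` N by exact: measurableD.
  apply/seteqP; split=> x [] xBH nN; split => //; first exact: BH.
  by apply: contrapT => nB; apply: nN; exact: HBN.
move=> cA; have AF k : exists N, [/\ measurable N, mu N = 0 & measurable ((A `&` F k) `\` N)].
  have [mFk Fk] := mF k; apply: fin.
    by apply: measurableI => //; exact: measurable_completion.
  apply: le_lt_trans Fk; rewrite -(measurable_mu_extE _ mFk) le_outer_measure//.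
have /choice[N hN] := AF.
have mN : measurable (\bigcup_k N k) by apply: bigcupT_measurable => k; have [] := hN k.
exists (\bigcup_k N k); split => //.
  apply/(negligibleP mu mN)/negligible_bigcup => k; have [mk k0 _] := hN k.
  exact/(negligibleP mu mk).
have -> : A `\` \bigcup_k N k = \bigcup_k (((A `&` F k) `\` N k) `\` \bigcup_k N k).
  apply/seteqP; split=> [x [Ax nN]|x [k _ [[[Ax _] _] nN]]//].
  have [k _ Fk] : (\bigcup_k F k) x by rewrite -TF.
  by exists k => //; do 2 split => //; move=> Nk; apply: nN; exists k.
by apply: bigcupT_measurable => k; apply: measurableD => //; have [] := hN k.
Qed.

(** The preimages of the countably many rays with rational endpoints leave
    only countably many null sets to discard. *)
Lemma completion_fun_core (D : set T) (f : T -> R) : measurable (D : set cT) ->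
  measurable_fun (D : set cT) f ->
  exists N, [/\ measurable N, mu N = 0, measurable (D `\` N) & measurable_fun (D `\` N) f].
Proof.
move=> cD mf.
pose rat_ k : R := ratr (odflt 0%R (unpickle k)).
have ray k : exists N, [/\ measurable N, mu N = 0 &
    measurable ((D `&` f @^-1` `]rat_ k, +oo[) `\` N)].
  by apply: completion_core; apply: mf => //; exact: measurable_itv.
have /choice[N hN] := ray.
have [ND [mND ND0 mDN]] := completion_core cD.
have mN : measurable (\bigcup_q N q) by apply: bigcupT_measurable => q; have [] := hN q.
have mDM : measurable (D `\` (ND `|` \bigcup_q N q)).
  rewrite -setDDl; exact: measurableD.
exists (ND `|` \bigcup_q N q); split => //.
- exact: measurableU.
- apply/(negligibleP mu (measurableU _ _ mND mN))/negligibleU.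
    exact/(negligibleP mu mND).
  apply: negligible_bigcup => k; have [mk k0 _] := hN k.
  exact/(negligibleP mu mk).
apply: (measurability _ (RGenOInfty.measurableE R)) => _ [_ [r ->] <-].
have -> : (D `\` (ND `|` \bigcup_q N q)) `&` f @^-1` `]r, +oo[ =
    \bigcup_(q in [set q | r <= rat_ q]%R)
      (((D `&` f @^-1` `]rat_ q, +oo[) `\` N q) `\` (ND `|` \bigcup_q N q)).
  apply/seteqP; split=> [x [[Dx nN] /=]|x [q /= rq [[[Dx fx] Nq] nN]]].
    rewrite in_itv/= andbT => /rat_in_itvoo[q]; rewrite in_itv/= => /andP[rq qf].
    have qE : rat_ (pickle q) = ratr q by rewrite /rat_ pickleK.
    exists (pickle q) => /=; first by rewrite qE ltW.
    split; last exact: nN.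
    split; first by split => //=; rewrite in_itv/= qE qf.
    by move=> Nq; apply: nN; right; exists (pickle q).
  split; first by split.
  by move: fx => /=; rewrite !in_itv/= !andbT; exact: le_lt_trans.
apply: bigcup_measurable => q _; apply: measurableD; last exact: measurableU.
by have [] := hN q.
Qed.

End completion.

(** * Bounded open sets of the Euclidean space *)

Section open_sets.
Context {R : realType} (d : nat).
Implicit Types (G : set 'rV[R]_d).

Lemma measurable_rV_box (A : 'I_d -> set R) : (forall i, measurable (A i)) ->
  measurable [set x : 'rV[R]_d | forall i, A i (x ord0 i)].
Proof.
move=> mA; rewrite (_ : [set _ | _] = \bigcap_(i in [set: 'I_d])
   (fun x : 'rV[R]_d => x ord0 i) @^-1` (A i)); last first.
  by apply/seteqP; split => x /= H i; [move=> _|]; exact: H.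
apply: fin_bigcap_measurable => [|i _]; first exact: finite_finset.
by rewrite -[X in measurable X]setTI; exact: measurable_coord.
Qed.

(** An open set is the countable union of the balls with rational centre and
    radius 1 / (n + 1) that it contains. *)
Lemma open_measurable_rV G : open G -> measurable G.
Proof.
move=> oG.
pose box (p : {ffun 'I_d -> rat} * nat) : set 'rV[R]_d :=
  [set x | forall i, ball (ratr (p.1 i) : R) p.2.+1%:R^-1 (x ord0 i)].
have -> : G = \bigcup_p (if `[< box p `<=` G >] then box p else set0).
  apply/seteqP; split=> [x Gx|x [p _]]; last by case: asboolP => // + ; exact.
  have /nbhs_ballP[e /= e0 xeG] : nbhs x G by exact: open_nbhs_nbhs.
  have e20 : 0 < e / 2 by rewrite divr_gt0.
  have [n _ /(_ n (leqnn n))/= ne] := near_infty_natSinv_lt (PosNum e20).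
  have n0 : (0 : R) < n.+1%:R^-1 by rewrite invr_gt0.
  have qx i : exists q : rat, `|ratr q - x ord0 i| < n.+1%:R^-1.
    have /rat_in_itvoo[q] : x ord0 i < x ord0 i + n.+1%:R^-1 by rewrite ltrDl.
    rewrite in_itv/= => /andP[q1 q2]; exists q; rewrite gtr0_norm ?subr_gt0//.
    by rewrite ltrBlDl.
  have /choice[q hq] := qx.
  exists ([ffun i => q i], n) => //; case: asboolP => [_ i|]; first by rewrite /= ffunE; exact: hq.
  move=> []; move=> y yq; apply: xeG; split => // i j.
  suff : `|x ord0 j - y ord0 j| < e.
    by move=> h; rewrite (ord1 i); exact: h.
  have /= := yq j; rewrite ffunE /ball/= => yqj; have xqj := hq j.
  rewrite distrC in xqj.
  apply: (le_lt_trans (ler_distD (ratr (q j)) _ _)); rewrite (splitr e).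
  by apply: ltrD; [exact: lt_trans xqj ne|exact: lt_trans yqj ne].
apply: countable_bigcupT_measurable => [|p]; first exact: countableP.
case: asboolP => // _.
apply: (@measurable_rV_box (fun i => ball (ratr (p.1 i) : R) p.2.+1%:R^-1)) => i.
exact: measurable_ball.
Qed.

Lemma lebesgue_rV_bounded G : measurable G -> bounded_set G ->
  (lebesgue_rV d G < +oo)%E.
Proof.
move=> mG [M [_ GM]]; pose r := `|M| + 1.
pose A (i : 'I_d) : set R := `[- r, r]%classic.
have mA i : measurable (A i) by exact: measurable_itv.
have GB : G `<=` [set x | forall i, A i (x ord0 i)].
  move=> x Gx i; rewrite /A/= in_itv/= -ler_norml.
  apply: (@le_trans _ _ `|x|); last by apply: GM => //; rewrite /r; have := ler_norm M; lra.
  by rewrite [leRHS]mx_normrE; apply/bigmax_geP; right; exists (ord0, i).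
apply: (@le_lt_trans _ _ (\prod_(i < d) lebesgue_measure (A i))%E).
  rewrite -(lebesgue_rV_box mA); apply: le_measure GB; rewrite inE//.
  exact: measurable_rV_box.
rewrite ltey_eq prode_fin_num// => i _; rewrite /A lebesgue_measure_itv/=.
by case: ifPn.
Qed.

End open_sets.

(** * Slices of a function measurable for a completed product *)

Section slices.
Context {d1 d2 : measure_display} {T1 : measurableType d1} {T2 : measurableType d2}
  {R : realType}.
Variables (m1 : {sigma_finite_measure set T1 -> \bar R})
  (m2 : {sigma_finite_measure set T2 -> \bar R}).
Local Notation m12 := (m1 \x m2)%E.
Local Notation c2 := (@completed_measure_extension _ _ _ m2).
Local Notation cT2 := (caratheodory_type (m2^*)%mu).
Local Notation c12 := (@completed_measure_extension _ _ _ m12).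
Local Notation cT12 := (caratheodory_type (m12^*)%mu).
Notation normc := Normc.normc.

Lemma product_sigma_finite : sigma_finite setT m12.
Proof.
have /sigma_finiteP[F [TF ndF Foo]] := sigma_finiteT m1.
have /sigma_finiteP[G [TG ndG Goo]] := sigma_finiteT m2.
exists (fun k => F k `*` G k).
  rewrite -setXTT TF TG predeqE => -[x y]; split=> [[[i _ Fx] [j _ Gy]]|].
    exists (maxn i j) => //; split.
    - by move/subsetPset: (ndF _ _ (leq_maxl i j)); exact.
    - by move/subsetPset: (ndG _ _ (leq_maxr i j)); exact.
  by move=> [k _ [? ?]]; split; exists k.
move=> k; have [mF Fk] := Foo k; have [mG Gk] := Goo k.
split; first exact: measurableX.
by rewrite [ltLHS]product_measure1E// lte_mul_pinfty// ge0_fin_numE.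
Qed.

Lemma null_xsection (N : set (T1 * T2)) : measurable N -> m12 N = 0%E ->
  m1.-negligible [set s | m2 (xsection N s) != 0%E].
Proof.
move=> mN N0; have mx := measurable_fun_xsection m2 mN.
have : (\int[m1]_x `|m2 (xsection N x)| = 0)%E.
  by under eq_integral do rewrite gee0_abs//; exact: N0.
move/(ae_eq_integral_abs m1 measurableT mx); apply: negligibleS => s /=.
by move=> /eqP sN /(_ I).
Qed.

(** The scalar products of the slices of a bounded u with a fixed
    square-integrable psi are a bounded function of the first variable,
    measurable up to a null set. Both u and psi are first replaced by functions
    measurable for the original sigma-algebras, to which Tonelli's theorem
    applies. *)
Lemma inner_slice (I : set T1) (G G0 : set T2) (psi : T2 -> R[i])
    (u : T1 -> T2 -> R[i]) :
  measurable I -> measurable G -> (m2 G < +oo)%E -> G0 `<=` G ->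
  measurable (G0 : set cT2) -> L2 c2 (G : set cT2) psi ->
  Linfty c12 ((I `*` G0) : set cT12) (fun z => u z.1 z.2) ->
  exists (hr hi : T1 -> R) (K : R) (Z : set T1),
    [/\ measurable_fun setT hr /\ measurable_fun setT hi,
        forall s, `|hr s| <= K /\ `|hi s| <= K,
        m1.-negligible Z &
        forall s, I s -> ~ Z s ->
          inner c2 (G : set cT2) (fun x => (\1_G0 x)%:C%C * u s x) psi =
          (hr s +i* hi s)%C].
Proof.
move=> mI mG Goo G0G cG0 Lpsi [[mur mui] [M uM]].
have sf2 := sigma_finiteT m2; have sf12 := product_sigma_finite.
have cG : measurable (G : set cT2) by exact: measurable_completion.
have [[mpr mpi] _] := Lpsi.
have [Nr [mNr Nr0 _ psir]] := completion_fun_core sf2 cG mpr.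
have [Ni [mNi Ni0 _ psii]] := completion_fun_core sf2 cG mpi.
have [N0 [mN0 N00 mGN0]] := completion_core sf2 cG0.
pose N1 := Nr `|` Ni `|` N0.
have mN1 : measurable N1 by apply: measurableU => //; exact: measurableU.
have negN1 : m2.-negligible N1.
  by do 2?apply: negligibleU; apply/negligibleP.
have N10 : m2 N1 = 0%E by exact/negligibleP.
pose E := G0 `\` N1.
have mE : measurable E.
  rewrite (_ : E = (G0 `\` N0) `\` (Nr `|` Ni)); last by rewrite setDDl setUC.
  by apply: measurableD => //; exact: measurableU.
have subE (N : set T2) : N `<=` N1 -> E `<=` G `\` N.
  by move=> NN1 x [G0x N1x]; split; [exact: G0G|move=> /NN1].
(* Measurable versions: psi' equals psi on G0 off N1, and vanishes elsewhere. *)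
pose psi' x : R[i] := if x \in E then psi x else 0.
have mpsi' : cmeasurable_fun setT psi'.
  have sr : E `<=` G `\` Nr by apply: subE => x ?; left; left.
  have si : E `<=` G `\` Ni by apply: subE => x ?; left; right.
  split.
    have /(measurable_restrictT _ mE) : measurable_fun E (fun x => complex.Re (psi x)).
      by apply: measurable_funS psir => //; apply: measurableD.
    by apply: eq_measurable_fun => x _; rewrite /patch /psi'; case: ifP.
  have /(measurable_restrictT _ mE) : measurable_fun E (fun x => complex.Im (psi x)).
    by apply: measurable_funS psii => //; apply: measurableD.
  by apply: eq_measurable_fun => x _; rewrite /patch /psi'; case: ifP.
have cD : measurable ((I `*` G0) : set cT12).
  have -> : I `*` G0 = (I `*` E) `|` (I `*` (G0 `&` N1)).
    apply/seteqP; split=> [[s x]/= [Is Gx]|[s x] /= [[? [? _]]|[? []]]]//.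
    by have [N1x|N1x] := pselect (N1 x); [right|left].
  apply: measurableU.
    by apply: measurable_completion; exact: measurableX.
  apply: negligible_completion; exists (setT `*` N1); split.
  - exact: measurableX.
  - by rewrite [LHS]product_measure1E// N10 mule0.
  - by move=> [s x] [_ []].
have [Ur [mUr Ur0 mDUr ur]] := completion_fun_core sf12 cD mur.
have [Ui [mUi Ui0 mDUi ui]] := completion_fun_core sf12 cD mui.
have [Ub [mUb Ub0 uUb]] := completion_negligible uM.
pose N2 := Ur `|` Ui `|` Ub.
have mN2 : measurable N2 by apply: measurableU => //; exact: measurableU.
have N20 : m12 N2 = 0%E.
  by apply/negligibleP => //; do 2?apply: negligibleU; apply/negligibleP.
pose W := (I `*` E) `\` N2.
have mW : measurable W by apply: measurableD => //; exact: measurableX.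
have subW (N : set (T1 * T2)) : N `<=` N2 -> W `<=` (I `*` G0) `\` N.
  by move=> NN2 [s x] [[Is [G0x _]] N2x]; split => // /NN2.
(* Likewise u' equals u on I x G0 off I x N1 and N2. *)
pose u' (z : T1 * T2) : R[i] := if z \in W then u z.1 z.2 else 0.
have mu' : cmeasurable_fun setT u'.
  have sr : W `<=` (I `*` G0) `\` Ur by apply: subW => x ?; left; left.
  have si : W `<=` (I `*` G0) `\` Ui by apply: subW => x ?; left; right.
  split.
    have /(measurable_restrictT _ mW) :
      measurable_fun W (fun z => complex.Re (u z.1 z.2)) by exact: measurable_funS ur.
    by apply: eq_measurable_fun => x _; rewrite /patch /u'; case: ifP.
  have /(measurable_restrictT _ mW) :
    measurable_fun W (fun z => complex.Im (u z.1 z.2)) by exact: measurable_funS ui.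
  by apply: eq_measurable_fun => x _; rewrite /patch /u'; case: ifP.
have u'M z : normc (u' z) <= `|M|.
  rewrite /u'; case: ifPn => [/set_mem Wz|_]; last by rewrite Normc.normc0.
  apply: le_trans (ler_norm _); apply: contrapT => uz.
  case: Wz => -[/= Iz [G0z _]] N2z; apply: N2z; right; apply: uUb => /=.
  by move=> h; apply: uz; apply: h; split.
pose F (z : T1 * T2) := u' z * conjc (psi' z.2).
have mF : cmeasurable_fun setT F.
  have m2psi : cmeasurable_fun setT (fun z : T1 * T2 => psi' z.2).
    by case: mpsi' => mr mi; split;
      [exact: (measurableT_comp mr measurable_snd)|exact: (measurableT_comp mi measurable_snd)].
  by apply: cmeasurable_funM => //; exact: cmeasurable_conj.
pose P x := normc (psi' x).
have mP : measurable_fun setT P by exact: measurable_normc.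
have PG x : ~ G x -> P x = 0.
  move=> nG; rewrite /P /psi'; case: ifPn; last by rewrite Normc.normc0.
  by move=> /set_mem[/G0G].
(* G has finite measure and P <= 1 + P ^ 2, so P is integrable. *)
have Pint : m2.-integrable setT (EFin \o P).
  apply/integrableP; split; first exact/measurable_EFinP.
  have PE x : (`|(EFin \o P) x| = (P x)%:E)%E by rewrite gee0_abs// lee_fin normc_ge0.
  under eq_integral do rewrite PE.
  have -> : (\int[m2]_x (P x)%:E = \int[m2]_(x in G) (P x)%:E)%E.
    rewrite [RHS]integral_mkcond; apply: eq_integral => x _; rewrite /patch.
    by case: ifPn => // /negP; rewrite inE => /PG ->.
  have mP2 : measurable_fun setT (fun x => P x ^+ 2) by exact: (measurable_funX 2).
  apply: (@le_lt_trans _ _ (\int[m2]_(x in G) (1 + (P x ^+ 2)%:E))%E).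
    apply: ge0_le_integral => //.
    - by move=> x _; rewrite lee_fin normc_ge0.
    - by apply/measurable_EFinP; exact: measurable_funTS.
    - by apply: emeasurable_funD => //; apply/measurable_EFinP; exact: measurable_funTS.
    - move=> x _; rewrite -EFinD lee_fin; have := sqr_ge0 (P x - 1); nra.
  rewrite ge0_integralD//; last 2 first.
    by move=> x _; rewrite lee_fin sqr_ge0.
    by apply/measurable_EFinP; exact: measurable_funTS.
  rewrite integral_cst// mul1e; apply: lte_add_pinfty => //.
  rewrite -(@integral_completion _ _ _ m2 G set0 (fun x => P x ^+ 2))//; last 2 first.
    exact: measurable_funTS.
    exact: negligible_set0.
  have /L2P[_ /integrableP[mpsi2]] := Lpsi; apply: le_lt_trans.
  under [leRHS]eq_integral do rewrite gee0_abs ?lee_fin ?sqr_ge0//.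
  apply: (ge0_le_integral c2 cG).
  - by move=> x _; rewrite lee_fin sqr_ge0.
  - apply/measurable_EFinP; apply: measurable_funTS.
    exact: (measurableT_comp mP2 (measurable_fun_completion (mu := m2))).
  - exact: mpsi2.
  - move=> x _; rewrite lee_fin /P /psi'; case: ifP => // _.
    by rewrite Normc.normc0 expr0n sqr_ge0.
have FP z : normc (F z) <= `|M| * P z.2.
  by rewrite /F normcM_conj ler_wpM2r ?normc_ge0.
pose K := `|M| * \int[m2]_x P x.
have slice (th : R[i] -> R) : (forall z, `|th z| <= normc z) ->
    measurable_fun setT (fun z => th (F z)) ->
    measurable_fun setT (fun s => \int[m2]_x th (F (s, x))) /\
    forall s, `|\int[m2]_x th (F (s, x))| <= K.
  move=> thn mth; split.
    have mthE : measurable_fun setT (EFin \o (fun z => th (F z))) by exact/measurable_EFinP.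
    rewrite /Rintegral; apply: (measurableT_comp (@fine_measurable R _ measurableT)).
    under [X in measurable_fun _ X]eq_fun do rewrite integralE.
    have mpos := @measurable_fun_fubini_tonelli_F _ _ T1 T2 R m2 _
      (measurable_funepos mthE) (fun=> funepos_ge0 _ _).
    have mneg := @measurable_fun_fubini_tonelli_F _ _ T1 T2 R m2 _
      (measurable_funeneg mthE) (fun=> funeneg_ge0 _ _).
    apply: eq_measurable_fun (emeasurable_funB mpos mneg) => s _; rewrite /fubini_F.
    by congr (_ - _)%E; apply: eq_integral => x _; rewrite ?funeposE ?funenegE.
  move=> s; have mths : measurable_fun setT (fun x => th (F (s, x))).
    exact: (measurableT_comp mth (pair1_measurable s)).
  have MPint : m2.-integrable setT (EFin \o (fun x => `|M| * P x)).
    exact: (integrableZl measurableT `|M| Pint).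
  have thint : m2.-integrable setT (EFin \o (fun x => th (F (s, x)))).
    apply: (le_integrable measurableT _ _ MPint); first exact/measurable_EFinP.
    move=> x _ /=; rewrite lee_fin.
    exact: (le_trans (thn _) (le_trans (FP (s, x)) (ler_norm _))).
  apply: le_trans (le_normr_Rintegral measurableT thint) _.
  rewrite /K -RintegralZl//; apply: le_Rintegral => //.
    have := integrable_abse thint; by apply: eq_integrable.
  by move=> x _; exact: (le_trans (thn _) (FP (s, x))).
have [mFr mFi] := mF.
have [mhr hrK] := slice _ (@ler_Re_normc _) mFr.
have [mhi hiK] := slice _ (@ler_Im_normc _) mFi.
exists (fun s => \int[m2]_x complex.Re (F (s, x))),
  (fun s => \int[m2]_x complex.Im (F (s, x))), K,
  [set s | m2 (xsection N2 s) != 0%E].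
split => //; first exact: null_xsection.
move=> s Is /negP/negPn/eqP N2s.
have negNs : m2.-negligible (N1 `|` xsection N2 s).
  apply: negligibleU => //; apply/negligibleP => //; exact: measurable_xsection.
have FE x : G x -> ~ (N1 `|` xsection N2 s) x ->
    (\1_G0 x)%:C%C * u s x * conjc (psi x) = F (s, x).
  move=> Gx /not_orP[N1x N2x]; rewrite /F /u' /psi' indicE.
  have {}N2x : ~ N2 (s, x).
    by move=> N2sx; apply: N2x; rewrite /xsection/= inE.
  have [G0x|G0x] := pselect (G0 x).
    by rewrite !mem_set//= mul1r.
  have nW : ~ W (s, x) by case=> -[_ []].
  by rewrite (memNset G0x) (memNset nW) /= !mul0r.
have key (th : R[i] -> R) : th 0 = 0 -> measurable_fun setT (fun z => th (F z)) ->
    \int[c2]_(x in G) th ((\1_G0 x)%:C%C * u s x * conjc (psi x)) =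
    \int[m2]_x th (F (s, x)).
  move=> th0 mth; rewrite /Rintegral; congr fine.
  rewrite (@integral_completion _ _ _ m2 G (N1 `|` xsection N2 s) _
    (fun x => th (F (s, x))))//.
  - rewrite integral_mkcond; apply: eq_integral => x _; rewrite /patch.
    case: ifPn => // /negP; rewrite inE => nGx.
    have : P x = 0 by exact: PG.
    rewrite /P => /Normc.eq0_normc p0.
    by rewrite /F /= p0 conjc0 mulr0 th0.
  - by apply: measurable_funTS; exact: (measurableT_comp mth (pair1_measurable s)).
  - by move=> x Gx nx; rewrite FE.
by apply: complex_ext; rewrite /= key.
Qed.

End slices.

(** * The controlled fractional equation *)

Section mode_series.
Context {R : realType} (d : nat).
Variables (alpha T : R) (G G0 : set 'rV[R]_d) (lam : nat -> R)
  (e : nat -> 'rV[R]_d -> R[i]) (y0 : 'rV[R]_d -> R[i])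
  (u : R -> 'rV[R]_d -> R[i]) (n : nat).
Hypotheses (alpha0 : 0 < alpha) (T0 : 0 < T).
Variables (h : R -> R[i]) (K : R) (Z : set (measurableTypeR R)).
Hypothesis mh : cmeasurable_fun (setT : set (measurableTypeR R)) h.
Hypothesis hK : forall s, Normc.normc (h s) <= K.
Hypothesis negZ : (@lebesgue_measure R).-negligible Z.
Hypothesis hE : forall s, `]0, T[%classic s -> ~ Z s ->
  inner (leb R d) G (fun x => (\1_G0 x)%:C%C * u s x) (e n) = h s.

(** The source enters a mode only through its scalar products h with one
    eigenfunction, known off a null set Z. *)
Lemma coord_solution_mode b xi :
  coord b (solution_mode alpha G G0 lam e y0 u xi n T) =
  limn (pseries (mode_coeff alpha T (inner (leb R d) G y0 (e n)) h b) (xi * lam n)).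
Proof.
rewrite -(mode_coeff_series _ alpha0 T0 mh hK) /solution_mode coord_add.
congr (_ + _).
transitivity (\int[completed_lebesgue_measure]_(s in `]0, T[) coord b
   (inner (leb R d) G (fun x => (\1_G0 x)%:C%C * u s x) (e n) *
    ((T - s) `^ (alpha - 1))%:C%C * mode_propagator alpha lam alpha xi n (T - s))).
  by case: b.
have mD : measurable (`]0, T[%classic : set (measurableTypeR R)) by exact: measurable_itv.
have hq r : 0 < r -> exists M,
    coeff_bound (fun k => (Gamma (alpha * k%:R + alpha))^-1) r M.
  exact: Gamma_coeff_bound.
have [mF _] := @kernel_series_measurable R T T0 alpha K (source_coord h b)
  (fun k => (Gamma (alpha * k%:R + alpha))^-1) alpha0 (measurable_source_coord mh b)
  (source_coord_le hK b) hq (xi * lam n).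
rewrite /Rintegral; congr fine.
apply: (@integral_transfer _ _ _ _ _ (@completed_lebesgue_measure R) (@lebesgue_measure R)
  (id : _ -> measurableTypeR R) _ _ completed_lebesgue_measure_is_complete _ Z) => //.
- by move=> _ A mA; rewrite setTI; exact: sub_caratheodory.
- apply: eq_measurable_fun mF => s _; congr (_ * _); apply: esym.
  exact: (@coord_mul_mittag_leffler R b alpha alpha _ (h s) alpha0 alpha0).
- move=> s Ds nZs; rewrite hE// mulrAC coord_mulr mulrC; congr (_ * _).
Qed.

End mode_series.
Theorem theorem3p1 (R : realType) (d : nat) (alpha T : R)
    (G G0 : set 'rV[R]_d)
    (lam : nat -> R) (e : nat -> 'rV[R]_d -> R[i])
    (y0 : 'rV[R]_d -> R[i]) (u : R -> 'rV[R]_d -> R[i])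
    (y : R -> R -> 'rV[R]_d -> R[i])
    (hd : (0 < d)%N)
    (halpha : 0 < alpha < 1)
    (hG : bounded_lipschitz_domain G)
    (hbasis : dirichlet_eigenbasis G lam e)
    (hG0G : G0 `<=` G)
    (hG0m : measurable (G0 : set (lebesgue_space R d)))
    (hG0 : (0 < leb R d G0)%E)
    (hT : 0 < T)
    (hy0 : L2 (leb R d) G y0)
    (hy0nz : ~ ae_zero (leb R d) G y0)
    (hu : Linfty (leb_spacetime R d) (`]0, T[ `*` G0) (fun z => u z.1 z.2))
    (hy : forall xi : R,
      fractional_schrodinger_solution alpha G G0 lam e y0 u T xi (y xi)) :
  countable [set xi : R | ae_zero (leb R d) G (y xi T)].
Proof.
have /andP[alpha0 _] := halpha.
have [oG _ _ bG _] := hG; have [lam0 ndlam _ _ he] := hbasis.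
have mG : measurable G := open_measurable_rV oG.
have cG : measurable (G : set (lebesgue_space R d)) by exact: measurable_completion.
have [n c0] : exists n, inner (leb R d) G y0 (e n) <> 0.
  apply: contrapT => /forallNP c0; apply: hy0nz.
  apply: (hilbert_basis_total cG he hy0) => n; apply: contrapT; exact: c0.
have lamn : 0 < lam n by rewrite (lt_le_trans lam0)// ndlam.
have eL : L2 (leb R d) G (e n) by have [] := he.
have [hr [hi [K [Z [[mhr mhi] hK negZ hE]]]]] :=
  @inner_slice _ _ (measurableTypeR R) 'rV[R]_d R (@lebesgue_measure R) (lebesgue_rV d)
    `]0, T[%classic G G0 (e n) u (measurable_itv _) mG (lebesgue_rV_bounded mG bG)
    hG0G hG0m eL hu.
pose h s : R[i] := (hr s +i* hi s)%C.
have mh : cmeasurable_fun (setT : set (measurableTypeR R)) h by [].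
have hK2 s : Normc.normc (h s) <= K + K.
  by rewrite (le_trans (normc_le_normD _))// lerD//; have [] := hK s.
have mode0 xi : ae_zero (leb R d) G (y xi T) ->
    solution_mode alpha G G0 lam e y0 u xi n T = 0.
  move=> yT0; have [|yL ycv] := hy xi T; first by rewrite lexx ltW.
  pose cmode m := solution_mode alpha G G0 lam e y0 u xi m T.
  exact: (@hilbert_basis_coeff_eq0 _ _ _ _ _ cG _ he cmode _ yL yT0 ycv n).
apply: contrapT => uncountable; apply: c0.
apply: (mode_coeff_eq0 alpha0 hT mh hK2) => b k.
have bound r : 0 < r -> exists M, coeff_bound (fun k =>
    mode_coeff alpha T (inner (leb R d) G y0 (e n)) h b k * lam n ^+ k) r M.
  move=> r0; have lr0 : 0 < lam n * r by rewrite mulr_gt0.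
  have [M hM] := @mode_coeff_bound R alpha T (inner (leb R d) G y0 (e n)) h _ alpha0 hT mh hK2 b _ lr0.
  by exists M; exact: (coeff_bound_scale (ltW lamn) hM).
have := pseries_uncountable_zeros bound _ uncountable k => /(_ _)/eqP.
rewrite mulf_eq0 expf_eq0 (gt_eqF lamn) andbF orbF => coef0; apply/eqP/coef0.
move=> xi /mode0 m0; rewrite -pseries_scale.
have mE := @coord_solution_mode R d alpha T G G0 lam e y0 u n alpha0 hT
  h (K + K) Z mh hK2 negZ hE b xi.
by rewrite -mE m0 coord0.
Qed.
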